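(* Let $\alpha>0$ and let $X_1,\ldots,X_n$ be i.i.d. random variables with the Gamma$(\alpha)$ distribution, i.e. with density $\Gamma(\alpha)^{-1}x^{\alpha-1}e^{-x}$ on $(0,\infty)$. Then for any integer $n\geq 1/\alpha$ and any nonnegative real numbers $d_1,\ldots,d_n$ satisfying $\sum_{i=1}^n d_i^2=1$ one has \[ h\Big(\sum_{i=1}^n d_iX_i\Big)\leq h\Big(\frac{1}{\sqrt n}\sum_{i=1}^n X_i\Big), \] with equality if and only if $d_1=\cdots=d_n=1/\sqrt n$.
   Context: For a real random variable $X$ with density $f$, its (Shannon differential) entropy is $h(X)=-\int f\ln f$, with the convention $0\ln 0=0$. *)

(* Defs.v *)
From HB Require Import structures.
From mathcomp Require Import all_boot all_order all_algebra.
From mathcomp Require Import all_classical all_reals all_analysis.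

Set Implicit Arguments.
Unset Strict Implicit.
Unset Printing Implicit Defensive.

Import Order.TTheory GRing.Theory Num.Theory.
Import numFieldNormedType.Exports.

Local Open Scope classical_set_scope.
Local Open Scope ring_scope.

Definition Gamma_fun {R : realType} (a : R) : R :=
  Rintegral (@lebesgue_measure R) `]0%R, +oo[%classic
    (fun x => x `^ (a - 1) * expR (- x)).

Definition gamma_pdf {R : realType} (a : R) (x : R) : R :=
  if 0 < x then (Gamma_fun a)^-1 * (x `^ (a - 1) * expR (- x)) else 0.

Definition xlnx {R : realType} (y : R) : R :=
  if y == 0 then 0 else y * ln y.

Definition is_density {d} {T : measurableType d} {R : realType}
    (P : probability T R) (Y : T -> R) (f : R -> R) : Prop :=
  measurable_fun setT f /\ (forall x, 0 <= f x) /\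
  forall A : set R, measurable A ->
    P (Y @^-1` A) = (\int[@lebesgue_measure R]_(x in A) (f x)%:E)%E.

Definition diff_entropy {R : realType} (f : R -> R) : \bar R :=
  (\int[@lebesgue_measure R]_x (- xlnx (f x))%:E)%E.

Definition mutually_independent {d} {T : measurableType d} {R : realType}
    (P : probability T R) (n : nat) (X : 'I_n -> T -> R) : Prop :=
  forall B : 'I_n -> set R, (forall i, measurable (B i)) ->
    P (\bigcap_i (X i @^-1` B i)) = (\prod_(i < n) P (X i @^-1` B i))%E.

(* Main.v *)
(** Put [b = sqrt n] and [s = \sum_i d i], so that [s <= b], with equality only for equal
    weights.  The variable [Z] has density [g0 = k x^(n alpha - 1) e^(- b x)], and
    [- ln g0 (x)] is, up to a constant, [b x - (n alpha - 1) ln x].  Assume [s < b] and shift [Y]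
    by [D = m (b - s) > 0], where [m] is the mean of [X_i], so that [Y + D] and [Z] have the same
    mean.  Gibbs' inequality for the density of [Y] against the shifted density [g0 (x + D)],
    restricted to [x > 0], gives
      [h(Y) <= E[- ln g0 (Y + D)] + P(Z > D) - 1 < E[- ln g0 (Y + D)]],
    and [h(Z) = E[- ln g0 (Z)]], so as [n alpha >= 1] it is enough that
    [E ln Z <= E ln (Y + D)].  This follows from the comparison
    [E e^(- u (Y + D)) <= E e^(- u Z)] of Laplace transforms, which by independence is Jensen's
    inequality for the concave function [v |-> sqrt v - ln (1 + sqrt v)]; the passage to
    logarithms uses
      [ln (M + x) - ln x = \int_0^M \int_0^oo e^(- u (s + x)) du ds]
    and [M -> +oo]. *)

Require Import Defs.
From HB Require Import structures.
From mathcomp Require Import all_boot all_order all_algebra.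
From mathcomp Require Import all_classical all_reals all_analysis.
From mathcomp Require Import measurable_realfun ring lra.

Import Order.TTheory GRing.Theory Num.Theory.
Import numFieldNormedType.Exports.

Local Open Scope classical_set_scope.
Local Open Scope ring_scope.

(** The shift is what makes the two logarithms comparable. Since [v |-> ln (1 + sqrt v)] is concave,
    [E e^(- u Y)] is at least [E e^(- u Z)], the wrong direction; the factor [e^(- u D)] supplies
    the term [sqrt v] in the function to which Jensen is applied, and the inequality turns round.
    The shift also settles the linear part [b x] of [- ln g0] by equal means, so that only the
    logarithm remains, with coefficient [- (n alpha - 1)]: the condition on [n] gives it the right
    sign. Strictness does not come from Jensen but from the shift: [Y] lives on [x > 0], where
    [g0 (x + D)] has only the mass [P(Z > D)]. No Gamma or Beta value is computed. Normalising
    constants are controlled by total mass one, and of the mean only [alpha <= m] is established,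
    the direction that the factor [e^(- u D)] asks for. *)

Section integral_EFin.
Context {d} {T : measurableType d} {R : realType} {mu : {measure set T -> \bar R}}.
Implicit Types f g : T -> R.

Lemma integrable_EFinD f g : mu.-integrable setT (fun x => (f x)%:E) ->
  mu.-integrable setT (fun x => (g x)%:E) ->
  mu.-integrable setT (fun x => (f x + g x)%:E).
Proof. by move=> fi gi; exact (integrableD measurableT fi gi). Qed.

Lemma integrable_EFinB f g : mu.-integrable setT (fun x => (f x)%:E) ->
  mu.-integrable setT (fun x => (g x)%:E) ->
  mu.-integrable setT (fun x => (f x - g x)%:E).
Proof. by move=> fi gi; exact (integrableB measurableT fi gi). Qed.

Lemma integrable_EFinZ (k : R) f : mu.-integrable setT (fun x => (f x)%:E) ->
  mu.-integrable setT (fun x => (k * f x)%:E).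
Proof. by move=> fi; exact (integrableZl measurableT k fi). Qed.

Lemma integral_EFinD f g : mu.-integrable setT (fun x => (f x)%:E) ->
  mu.-integrable setT (fun x => (g x)%:E) ->
  (\int[mu]_x (f x + g x)%:E = \int[mu]_x (f x)%:E + \int[mu]_x (g x)%:E)%E.
Proof. by move=> fi gi; exact (integralD measurableT fi gi). Qed.

Lemma integral_EFinB f g : mu.-integrable setT (fun x => (f x)%:E) ->
  mu.-integrable setT (fun x => (g x)%:E) ->
  (\int[mu]_x (f x - g x)%:E = \int[mu]_x (f x)%:E - \int[mu]_x (g x)%:E)%E.
Proof. by move=> fi gi; exact (integralB measurableT fi gi). Qed.

Lemma integral_EFinZ (k : R) f : mu.-integrable setT (fun x => (f x)%:E) ->
  (\int[mu]_x (k * f x)%:E = k%:E * \int[mu]_x (f x)%:E)%E.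
Proof. by move=> fi; exact (integralZl measurableT fi k). Qed.

End integral_EFin.

Lemma integrable_EFin_cst {d} {T : measurableType d} {R : realType}
  (P : probability T R) (k : R) : P.-integrable setT (fun=> k%:E).
Proof. exact (finite_measure_integrable_cst P k measurableT). Qed.

Lemma integral_EFin_cst {d} {T : measurableType d} {R : realType}
  (P : probability T R) (k : R) : (\int[P]_x k%:E = k%:E)%E.
Proof. by rewrite integral_cst//= probability_setT mule1. Qed.

(** By uniqueness of Lebesgue measure, checked on half-open intervals, [lebesgue_measure] is [b]
    times its own image under [x |-> b x + c]; the integral formula restates this identity of
    measures. *)
Lemma ge0_integral_affine {R : realType} (b c : R) (h : R -> \bar R) :
  0 < b -> measurable_fun setT h -> (forall x, (0 <= h x)%E) ->
  (\int[@lebesgue_measure R]_x h (b * x + c)%R =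
   b^-1%:E * \int[@lebesgue_measure R]_x h x)%E.
Proof.
move=> b0 mh h0.
pose phi : R -> measurableTypeR R := fun x => b * x + c.
have mphi : measurable_fun setT phi.
  by apply: measurable_funD => //; exact: measurable_funM.
pose m0 := mscale (NngNum (ltW b0)) (pushforward (@lebesgue_measure R) phi).
pose m' : measure (measurableTypeR R) R := m0 mphi.
have m'E A : measurable A -> lebesgue_measure A = m' A.
  apply: lebesgue_measure_unique => _ [[u v] _ <-].
  have phiE : phi @^-1` `]u, v]%classic = `](u - c) / b, (v - c) / b]%classic.
    apply/seteqP; split=> x /=; rewrite !in_itv/= ltr_pdivrMr// ler_pdivlMr//;
      by rewrite /phi ltrBlDr lerBrDr (mulrC x).
  have -> : m' `]u, v]%classic =
      (b%:E * lebesgue_measure (phi @^-1` `]u, v]%classic))%E by [].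
  rewrite phiE !lebesgue_measure_itv/= !lte_fin ltr_pM2r ?invr_gt0// ltrD2r.
  case: ifPn => _; last by rewrite mule0.
  by rewrite -!EFinB -EFinM; congr EFin; field; rewrite gt_eqF.
have -> : (\int[@lebesgue_measure R]_x h x = \int[m']_x h x)%E.
  by apply: eq_measure_integral => A mA _; exact: m'E.
rewrite ge0_integral_mscale//= ge0_integral_pushforward//= preimage_setT.
by rewrite muleA -EFinM mulVf ?gt_eqF// mul1e.
Qed.

(** * Laws with a density *)

Section density.
Context {d} {T : measurableType d} {R : realType}.
Variables (P : probability T R) (Y : T -> R) (f : R -> R).
Hypotheses (mY : measurable_fun setT Y) (Yf : is_density P Y f).
Local Notation mu := (@lebesgue_measure R).

(** [is_density] speaks of probabilities only. The law of [Y] is dominated by Lebesgue measure, [f]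
    agrees almost everywhere with its Radon-Nikodym derivative, and the change of variables for the
    latter handles any nonnegative [h]. *)
Lemma is_density_ge0_integral (h : R -> \bar R) :
  measurable_fun setT h -> (forall x, (0 <= h x)%E) ->
  (\int[P]_t h (Y t) = \int[mu]_x (h x * (f x)%:E))%E.
Proof.
move=> mh h0; have [mf [f0 PYf]] := Yf.
have mY' : @measurable_fun _ _ T (measurableTypeR R) setT Y := mY.
pose Y' : {RV P >-> measurableTypeR R} := @mfun_Sub _ _ T (measurableTypeR R) Y (mem_set mY').
pose nu : {finite_measure set (measurableTypeR R) -> \bar R} :=
  distribution P Y'.
have intf A : measurable A ->
    nu A = (\int[mu]_(x in A) (f x)%:E)%E.
  by move=> mA; rewrite -PYf.
have PYmu : nu `<< mu.
  apply/null_content_dominatesP => A mA muA0.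
  by rewrite intf//; apply: null_set_integral => //;
    exact/measurable_funTS/measurable_EFinP.
transitivity (\int[nu]_x h x)%E.
  by rewrite [RHS]ge0_integral_distribution.
rewrite -(Radon_Nikodym_SigmaFinite.change_of_variables PYmu)//.
have RNf : ae_eq mu setT
    (Radon_Nikodym_SigmaFinite.f nu mu) (EFin \o f).
  apply: integral_ae_eq => //.
  - exact: Radon_Nikodym_SigmaFinite.f_integrable.
  - exact/measurable_EFinP.
  - move=> E _ mE.
    by rewrite -Radon_Nikodym_SigmaFinite.f_integral// intf.
have mRN := measurable_int _ (Radon_Nikodym_SigmaFinite.f_integrable PYmu).
apply: ge0_ae_eq_integral => //.
- exact: emeasurable_funM.
- by apply: emeasurable_funM => //; exact/measurable_EFinP.
- by move=> x _; rewrite mule_ge0// Radon_Nikodym_SigmaFinite.f_ge0.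
- by move=> x _; rewrite mule_ge0// lee_fin.
- by apply: filterS RNf => x /(_ Logic.I) RNfx _; rewrite RNfx.
Qed.

Lemma is_density_integral1 : (\int[mu]_x (f x)%:E = 1)%E.
Proof. by have [_ [_ <-//]] := Yf; rewrite preimage_setT probability_setT. Qed.

Lemma is_density_integrable : mu.-integrable setT (EFin \o f).
Proof.
have [mf [f0 _]] := Yf; apply/integrableP; split; first exact/measurable_EFinP.
under eq_integral do rewrite /= ger0_norm//.
by rewrite is_density_integral1 ltry.
Qed.

Lemma is_density_integrableM (h : R -> R) : measurable_fun setT h ->
  P.-integrable setT (EFin \o h \o Y) ->
  mu.-integrable setT (fun x => (h x * f x)%:E).
Proof.
move=> mh /integrableP[_ ih]; have [mf [f0 _]] := Yf.
apply/integrableP; split; first by apply/measurable_EFinP/measurable_funM.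
have /= ih' := is_density_ge0_integral (fun x => `|h x|%:E) _ _.
under eq_integral do rewrite /= normrM (ger0_norm (f0 _)) EFinM.
by rewrite -ih'//; apply/measurable_EFinP/measurableT_comp.
Qed.

Lemma is_density_integral (h : R -> R) : measurable_fun setT h ->
  P.-integrable setT (EFin \o h \o Y) ->
  (\int[P]_t (h (Y t))%:E = \int[mu]_x (h x * f x)%:E)%E.
Proof.
move=> mh ih; have [mf [f0 _]] := Yf.
have mhE : measurable_fun setT (EFin \o h) by exact/measurable_EFinP.
rewrite integralE [RHS]integralE.
congr (_ - _)%E.
- transitivity (\int[P]_t (EFin \o h)^\+ (Y t))%E.
    by apply: eq_integral => t _; rewrite !funeposE.
  rewrite is_density_ge0_integral//; last exact: measurable_funepos.
  apply: eq_integral => x _; rewrite !funeposE /= -!EFin_max -EFinM.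
  by rewrite maxr_pMl// mul0r.
- transitivity (\int[P]_t (EFin \o h)^\- (Y t))%E.
    by apply: eq_integral => t _; rewrite !funenegE.
  rewrite is_density_ge0_integral//; last exact: measurable_funeneg.
  apply: eq_integral => x _; rewrite !funenegE /= -!EFin_max -EFinM.
  by rewrite maxr_pMl// mul0r mulNr.
Qed.

End density.

Lemma measurable_xlnx {R : realType} : measurable_fun setT (@xlnx R).
Proof.
rewrite (_ : xlnx = fun y => y * ln y); last first.
  by apply/funext => y; rewrite /xlnx; case: eqP => // ->; rewrite mul0r.
exact: measurable_funM.
Qed.

(** Two densities of one law agree almost everywhere, so the entropy depends on the law alone.
    Arbitrary versions may thus be replaced by the explicit gamma density, or by one that vanishes
    off the positive half-line. *)
Lemma is_density_entropy_unique {d} {T : measurableType d} {R : realType}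
    (P : probability T R) (Y : T -> R) (f g : R -> R) :
  is_density P Y f -> is_density P Y g -> diff_entropy f = diff_entropy g.
Proof.
move=> Yf Yg; have [mf [f0 Ef]] := Yf; have [mg [g0 Eg]] := Yg.
have fg : ae_eq lebesgue_measure setT (EFin \o f) (EFin \o g).
  apply: integral_ae_eq => //.
  - exact: is_density_integrable Yf.
  - exact/measurable_EFinP.
  - by move=> E _ mE; rewrite -Ef// -Eg.
apply: ae_eq_integral => //.
- by apply/measurable_EFinP/measurableT_comp => //; apply/measurableT_comp => //; exact: measurable_xlnx.
- by apply/measurable_EFinP/measurableT_comp => //; apply/measurableT_comp => //; exact: measurable_xlnx.
- by apply: filterS fg => x /(_ Logic.I) [->].
Qed.

(** * Independence and partial sums *)

Definition indep_pair {d} {T : measurableType d} {R : realType}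
    (P : probability T R) (U V : T -> R) : Prop :=
  forall A B : set R, measurable A -> measurable B ->
    P (U @^-1` A `&` V @^-1` B) = (P (U @^-1` A) * P (V @^-1` B))%E.

Section indep_pair.
Context {d} {T : measurableType d} {R : realType}.
Variable P : probability T R.

(** Restricting [P] to [E] and dividing by [P E] gives a measure whose image under [(U, V)] factors
    on rectangles, hence is the product law by uniqueness. The event [E] carries the constraints on
    variables that have not yet been summed. *)
Lemma indep_event_joint_law (U V : {RV P >-> R}) (E : set T) :
  measurable E ->
  (forall A B : set R, measurable A -> measurable B ->
    P (E `&` (U @^-1` A `&` V @^-1` B)) =
    P E * (P (U @^-1` A) * P (V @^-1` B)))%E ->
  forall C : set (R * R), measurable C ->
    (P (E `&` [set t | C (U t, V t)]) =
     P E * (distribution P U \x distribution P V) C)%E.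
Proof.
move=> mE EUV C mC.
have mUV : measurable_fun setT (fun t => (U t, V t)).
  by apply/measurable_fun_pair; exact: measurable_funP.
have mUVC : measurable [set t | C (U t, V t)].
  by rewrite -[X in measurable X]setTI; exact: mUV.
have PEfin : P E \is a fin_num by exact: fin_num_measure.
(* A null event cannot be normalised, but then both sides vanish. *)
have [PE0|PE0] := eqVneq (P E) 0%E.
  rewrite PE0 mul0e; apply/eqP; rewrite -measure_le0 -PE0.
  by apply: le_measure; rewrite ?inE//; exact: measurableI.
have c0 : 0 <= (fine (P E))^-1 by rewrite invr_ge0 fine_ge0.
pose m0 := mscale (NngNum c0) (pushforward (mrestr P mE) (fun t => (U t, V t))).
pose m : measure (R * R)%type R := m0 mUV.
have mEr A : m A = ((fine (P E))^-1%:E * P ((fun t => (U t, V t)) @^-1` A `&` E))%E.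
  by [].
have cPE x : ((fine (P E))^-1%:E * (P E * x) = x)%E.
  rewrite muleA -[X in (_ * X * _)%E](fineK PEfin) -EFinM mulVf ?mul1e//.
  by rewrite fine_eq0.
rewrite (@product_measure_unique _ _ _ _ _ _ _ m)//=.
  rewrite mEr setIC -[LHS]mul1e -(@divff _ (fine (P E))) ?fine_eq0// EFinM.
  by rewrite -muleA fineK.
move=> A B mA mB; rewrite mEr setIC.
by rewrite (_ : _ @^-1` (A `*` B) = U @^-1` A `&` V @^-1` B)// EUV// cPE.
Qed.

(** Independence turns the joint law into the product law, and Tonelli then lets the two coordinates
    run over separate sample points. *)
Lemma indep_pair_ge0_integral (U V : T -> R) (F : R * R -> \bar R) :
  measurable_fun setT U -> measurable_fun setT V -> indep_pair P U V ->
  measurable_fun setT F -> (forall x, 0 <= F x)%E ->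
  (\int[P]_t F (U t, V t) = \int[P]_t \int[P]_s F (U t, V s))%E.
Proof.
move=> mU mV UV mF F0.
pose U' : {RV P >-> R} := mfun_Sub (mem_set mU).
pose V' : {RV P >-> R} := mfun_Sub (mem_set mV).
have mUV : measurable_fun setT (fun t => (U t, V t)).
  exact/measurable_fun_pair.
pose W : {RV P >-> (R * R)%type} := mfun_Sub (mem_set mUV).
transitivity (\int[distribution P W]_x F x)%E.
  by rewrite [RHS]ge0_integral_distribution.
transitivity (\int[distribution P U' \x distribution P V']_x F x)%E.
  apply: eq_measure_integral => C mC _.
  have /= := indep_event_joint_law U' V' setT measurableT _ C mC.
  rewrite setTI probability_setT mul1e /= => <-; last first.
    by move=> A B mA mB; rewrite setTI mul1e UV.
  by [].
rewrite fubini_tonelli1//.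
rewrite ge0_integral_distribution/=; last 2 first.
- exact: measurable_fun_fubini_tonelli_F.
- by move=> x; apply: integral_ge0.
apply: eq_integral => t _ /=; rewrite /fubini_F ge0_integral_distribution//.
exact: measurableT_comp.
Qed.

End indep_pair.

(** All partial sums range over the same index type ['I_n], cut by [i < k], so that an induction on
    [k] keeps weights and variables fixed. *)
Definition partial_sum {T : Type} {R : realType} {n : nat} (c : 'I_n -> R)
  (X : 'I_n -> T -> R) (k : nat) (t : T) : R :=
  \sum_(i < n | (i < k)%N) c i * X i t.

Lemma partial_sum0 {T : Type} {R : realType} {n : nat} (c : 'I_n -> R)
  (X : 'I_n -> T -> R) t : partial_sum c X 0 t = 0.
Proof. by rewrite /partial_sum big_pred0. Qed.

Lemma partial_sumS {T : Type} {R : realType} {n : nat} (c : 'I_n -> R)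
  (X : 'I_n -> T -> R) (j : 'I_n) t :
  partial_sum c X j.+1 t = partial_sum c X j t + c j * X j t.
Proof.
rewrite /partial_sum (bigD1 j) ?ltnS//= addrC; congr (_ + _).
apply: eq_bigl => i; rewrite ltnS leq_eqVlt -val_eqE.
by case: (ltngtP i j).
Qed.

Lemma partial_sum_full {T : Type} {R : realType} {n : nat} (c : 'I_n -> R)
  (X : 'I_n -> T -> R) t : partial_sum c X n t = \sum_(i < n) c i * X i t.
Proof. by apply: eq_bigl => i; rewrite ltn_ord. Qed.

Section partial_sum.
Context {d} {T : measurableType d} {R : realType}.
Variables (P : probability T R) (n : nat) (X : 'I_n -> T -> R) (c : 'I_n -> R).
Hypotheses (mX : forall i, measurable_fun setT (X i))
  (indX : mutually_independent P X).

Lemma measurable_partial_sum k : measurable_fun setT (partial_sum c X k).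
Proof.
rewrite (_ : partial_sum c X k =
    fun t => \sum_(i < n) (if (i < k)%N then c i * X i t else 0)); last first.
  by apply/funext => t; exact: big_mkcond.
by apply: measurable_sum => i; case: (i < k)%N => //; exact: measurable_funM.
Qed.

(** Independence of the partial sum from the next variable alone is too weak for an induction. The
    statement therefore keeps constraints on all remaining variables, with [setT] at the indices
    already summed. *)
Lemma partial_sum_indep_tail k (B : 'I_n -> set R) (A : set R) :
  measurable A -> (forall i, measurable (B i)) ->
  (forall i : 'I_n, (i < k)%N -> B i = setT) ->
  P (partial_sum c X k @^-1` A `&` \bigcap_i (X i @^-1` B i)) =
  (P (partial_sum c X k @^-1` A) * \prod_(i < n) P (X i @^-1` B i))%E.
Proof.
elim: k B A => [|k IH] B A mA mB Bk.
  have -> : partial_sum c X 0 = cst 0 by apply/funext => t; exact: partial_sum0.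
  rewrite preimage_cst; case: ifPn => _.
    by rewrite setTI probability_setT mul1e indX.
  by rewrite set0I measure0 mul0e.
have [kn|nk] := ltnP k n; last first.
  have -> : partial_sum c X k.+1 = partial_sum c X k.
    apply/funext => t; apply: eq_bigl => i.
    by rewrite !(leq_trans (ltn_ord i))// ltnW.
  by apply: IH => // i ik; apply: Bk; exact: ltnW.
pose j := Ordinal kn.
have mS := measurable_partial_sum k.
pose U : {RV P >-> R} := mfun_Sub (mem_set mS).
pose V : {RV P >-> R} := mfun_Sub (mem_set (mX j)).
have joint (B' : 'I_n -> set R) : (forall i, measurable (B' i)) ->
    (forall i : 'I_n, (i < k.+1)%N -> B' i = setT) ->
    forall C : set (R * R), measurable C ->
    (P (\bigcap_i (X i @^-1` B' i) `&` [set t | C (U t, V t)]) =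
     P (\bigcap_i (X i @^-1` B' i)) * (distribution P U \x distribution P V) C)%E.
  move=> mB' B'k; apply: indep_event_joint_law.
    apply: fin_bigcap_measurable => // i _.
    by rewrite -[X in measurable X]setTI; exact: mX.
  move=> A1 A2 mA1 mA2.
  (* The constraint on [X j] is written into coordinate [j], where [B'] imposes nothing, so that the
     induction hypothesis applies at [k]. *)
  pose B2 i := if i == j then A2 else B' i.
  have -> : \bigcap_i (X i @^-1` B' i) `&` (U @^-1` A1 `&` V @^-1` A2) =
      partial_sum c X k @^-1` A1 `&` \bigcap_i (X i @^-1` B2 i).
    apply/seteqP; split => [t [Bt [At Vt]]|t [At Bt]]; split => //.
    - move=> i _; rewrite /B2 /preimage/=; case: eqP => [->//|_].
      exact: Bt.
    - move=> i _; have := Bt i Logic.I; rewrite /B2 /preimage/=.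
      by case: eqP => // -> _; rewrite B'k//=.
    - split=> //; have := Bt j Logic.I.
      by rewrite /B2 /preimage/= eqxx.
  rewrite IH//; last 2 first.
  - by move=> i; rewrite /B2; case: ifP.
  - move=> i ik; rewrite /B2 -val_eqE /= ltn_eqF//.
    by apply: B'k; exact: ltnW.
  rewrite indX// (bigD1 j)//= [in RHS](bigD1 j)//= B'k//= preimage_setT.
  rewrite probability_setT mul1e /B2 eqxx.
  under eq_bigr => i /negPf -> do [].
  by rewrite muleA muleC.
pose C := [set uv : R * R | A (uv.1 + c j * uv.2)].
have mC : measurable C.
  have mf : measurable_fun setT (fun uv : R * R => uv.1 + c j * uv.2).
    by apply: measurable_funD => //; exact: measurable_funM.
  by rewrite -[X in measurable X]setTI; exact: mf.
have SC : partial_sum c X k.+1 @^-1` A = [set t | C (U t, V t)].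
  by apply/seteqP; split => t; rewrite /preimage/= (partial_sumS c X j).
have := joint (fun=> setT) (fun=> measurableT) (fun _ _ => erefl) C mC.
rewrite bigcapT; last by [].
rewrite setTI probability_setT mul1e -SC => ->.
rewrite setIC SC (joint B)// muleC indX//.
Qed.

Lemma partial_sum_indep (j : 'I_n) :
  indep_pair P (partial_sum c X j) (X j).
Proof.
move=> A B mA mB.
pose B' i := if i == j then B else setT.
have := partial_sum_indep_tail j B' A mA.
have -> : \bigcap_i (X i @^-1` B' i) = X j @^-1` B.
  apply/seteqP; split => [t /(_ j Logic.I)|t Bt i _]; rewrite /B' /preimage/=.
    by rewrite eqxx.
  by case: eqP => // ->.
move=> ->.
- congr (_ * _)%E; rewrite (bigD1 j)//= /B' eqxx.
  rewrite big1 ?mule1// => i /negPf ->.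
  by rewrite preimage_setT probability_setT.
- by move=> i; rewrite /B'; case: ifP.
- by move=> i ij; rewrite /B' -val_eqE ltn_eqF.
Qed.

End partial_sum.

(** * Densities of sums and the gamma law *)

Section density_operations.
Context {d} {T : measurableType d} {R : realType}.
Variable P : probability T R.
Local Notation mu := (@lebesgue_measure R).

Lemma integral_indicM (A : set R) (F : R -> \bar R) : measurable A ->
  (\int[mu]_(x in A) F x = \int[mu]_x ((\1_A x)%:E * F x))%E.
Proof.
move=> mA; rewrite integral_mkcond; apply: eq_integral => x _.
rewrite patchE indicE; case: ifPn => _; rewrite ?mul1e ?mul0e//.
Qed.

Lemma is_density_scale (V : T -> R) (p : R -> R) (c : R) : 0 < c ->
  is_density P V p ->
  is_density P (fun t => c * V t) (fun x => c^-1 * p (c^-1 * x)).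
Proof.
move=> c0 [mp [p0 Vp]].
have mp' : measurable_fun setT (fun x => c^-1 * p (c^-1 * x)).
  by apply: measurable_funM => //; apply: measurableT_comp => //;
    exact: measurable_funM.
split; first exact: mp'.
split; first by move=> x; rewrite mulr_ge0// invr_ge0 ltW.
move=> A mA.
have mcA : measurable [set x | A (c * x)].
  have mc : measurable_fun setT (fun x : R => c * x) by exact: measurable_funM.
  by rewrite -[X in measurable X]setTI; exact: mc.
transitivity (P (V @^-1` [set x | A (c * x)])); first by [].
rewrite Vp// integral_indicM// [RHS]integral_indicM//.
pose h x : \bar R := ((\1_A x)%:E * (p (c^-1 * x))%:E)%E.
have mh : measurable_fun setT h.
  apply: emeasurable_funM; apply/measurable_EFinP => //.
  by apply: measurableT_comp => //; exact: measurable_funM.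
have h0 x : (0 <= h x)%E by rewrite mule_ge0// lee_fin.
transitivity (\int[mu]_x h (c * x + 0)%R)%E.
  by apply: eq_integral => x _; rewrite /h addr0 mulKf ?gt_eqF// !indicE.
rewrite (ge0_integral_affine c 0 h c0 mh h0) -ge0_integralZl//; last first.
  by rewrite lee_fin invr_ge0 ltW.
by apply: eq_integral => x _; rewrite /h EFinM muleCA.
Qed.

Section sum.
Variables (U V : T -> R) (p : R -> R).
Hypotheses (mU : measurable_fun setT U) (mV : measurable_fun setT V).
Hypotheses (UV : indep_pair P U V) (Vp : is_density P V p).

(** The convolution of [p] with the law of [U], written as an expectation because [U] may have no
    density, for instance when it is a partial sum whose weights all vanish. Its values are extended
    reals since it may be infinite at some points. *)
Let F x : \bar R := (\int[P]_t (p (x - U t)%R)%:E)%E.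

Let mpxU : measurable_fun setT (fun xt : R * T => (p (xt.1 - U xt.2))%:E).
Proof.
have [mp _] := Vp; apply/measurable_EFinP/measurableT_comp => //.
by apply: measurable_funB => //; exact: measurableT_comp.
Qed.

Lemma measurable_density_sum : measurable_fun setT F.
Proof.
have [_ [p0 _]] := Vp.
apply: (measurable_fun_fubini_tonelli_F
  (fun xt : R * T => (p (xt.1 - U xt.2))%:E)) => //=.
by move=> x; rewrite lee_fin.
Qed.

Lemma indep_pair_sum_law (A : set R) : measurable A ->
  (P ((fun t => U t + V t)%R @^-1` A) = \int[mu]_(x in A) F x)%E.
Proof.
move=> mA; have [mp [p0 _]] := Vp.
have mUVA : measurable ((fun t => U t + V t) @^-1` A).
  have mUV : measurable_fun setT (fun t => U t + V t).
    exact: measurable_funD.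
  by rewrite -[X in measurable X]setTI; exact: mUV.
transitivity (\int[P]_t (\1_A (U t + V t)%R)%:E)%E.
  by rewrite -[X in P X]setIT -integral_indic.
have mI : measurable_fun setT (fun x : R * R => (\1_A (x.1 + x.2)%R : R)%:E).
  by apply/measurable_EFinP/measurableT_comp => //; exact: measurable_funD.
rewrite (indep_pair_ge0_integral P U V
  (fun x : R * R => (\1_A (x.1 + x.2)%R)%:E) mU mV UV mI)/=; last first.
  by move=> x; rewrite lee_fin.
transitivity (\int[P]_t \int[mu]_x ((\1_A x)%:E * (p (x - U t)%R)%:E))%E.
  apply: eq_integral => t _.
  rewrite (is_density_ge0_integral P V p mV Vp (fun v => (\1_A (U t + v)%R)%:E));
    last 2 first.
  - by apply/measurable_EFinP/measurableT_comp => //; exact: measurable_funD.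
  - by move=> x; rewrite lee_fin.
  pose h x : \bar R := ((\1_A x)%:E * (p (x - U t)%R)%:E)%E.
  transitivity (\int[mu]_x h (1 * x + U t)%R)%E.
    by apply: eq_integral => x _; rewrite /h mul1r addrK addrC.
  rewrite (ge0_integral_affine 1 (U t) h)// ?invr1 ?mul1e//.
    apply: emeasurable_funM; apply/measurable_EFinP => //.
    by apply: measurableT_comp => //; exact: measurable_funB.
  by move=> x; rewrite mule_ge0// lee_fin.
rewrite integral_indicM//.
rewrite (@fubini_tonelli _ _ _ _ _ P mu
  (fun tx : T * R => ((\1_A tx.2)%:E * (p (tx.2 - U tx.1)%R)%:E)%E))/=; last 2 first.
- apply: emeasurable_funM; apply/measurable_EFinP; apply: measurableT_comp => //.
  by apply: measurable_funB => //; exact: measurableT_comp.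
- by move=> x; rewrite mule_ge0// lee_fin.
apply: eq_integral => x _; rewrite ge0_integralZl//.
- apply/measurable_EFinP/measurableT_comp => //.
  by apply: measurable_funB.
- by move=> t _; rewrite lee_fin.
Qed.

Lemma integral_density_sum : (\int[mu]_x F x = 1)%E.
Proof.
by rewrite -indep_pair_sum_law// preimage_setT probability_setT.
Qed.

Lemma density_sum_ge0 x : (0 <= F x)%E.
Proof.
by have [_ [p0 _]] := Vp; apply: integral_ge0 => t _; rewrite lee_fin.
Qed.

(** The convolution has integral one, so it is finite almost everywhere and [fine] alters it only on
    a null set. *)
Lemma is_density_sum : is_density P (fun t => U t + V t) (fine \o F).
Proof.
have iF : mu.-integrable setT F.
  apply/integrableP; split; first exact: measurable_density_sum.
  under eq_integral do rewrite gee0_abs ?density_sum_ge0//.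
  by rewrite integral_density_sum ltry.
split; first by apply: measurableT_comp => //; exact: measurable_density_sum.
split; first by move=> x; rewrite fine_ge0// density_sum_ge0.
move=> A mA; rewrite indep_pair_sum_law//; apply: ae_eq_integral => //.
- apply: measurable_funTS; exact: measurable_density_sum.
- apply/measurable_funTS/measurable_EFinP/measurableT_comp => //.
  exact: measurable_density_sum.
- have := integrable_ae measurableT iF.
  by apply: filterS => x /(_ Logic.I) Fx _ /=; rewrite fineK.
Qed.

End sum.

End density_operations.

(** The gamma density of shape [a] and rate [b] without its normalising constant; rate [0] leaves
    the power that occurs in the Beta integral. *)
Definition gamma_kernel {R : realType} (a b x : R) : R :=
  if 0 < x then x `^ (a - 1) * expR (- (b * x)) else 0.

Section gamma_kernel.
Context {R : realType}.
Implicit Types a b c x : R.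
Local Notation mu := (@lebesgue_measure R).

Lemma gamma_kernel_ge0 a b x : 0 <= gamma_kernel a b x.
Proof. by rewrite /gamma_kernel; case: ifP => // _; rewrite mulr_ge0 ?powR_ge0 ?expR_ge0. Qed.

Lemma measurable_gamma_kernel a b : measurable_fun setT (gamma_kernel a b).
Proof.
apply: measurable_fun_ifT => //.
- exact: measurable_fun_ltr.
- apply: measurable_funM; first exact: measurable_powR.
  by apply: measurableT_comp => //; apply: measurableT_comp => //; exact: measurable_funM.
Qed.

Lemma gamma_kernel_scale a b c x : 0 < c ->
  gamma_kernel a b (c * x) = c `^ (a - 1) * gamma_kernel a (b * c) x.
Proof.
move=> c0; rewrite /gamma_kernel pmulr_rgt0//; case: ifPn => x0; last by rewrite mulr0.
by rewrite powRM ?ltW// !mulrA.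
Qed.

Lemma gamma_pdfE a x : gamma_pdf a x = (Gamma_fun a)^-1 * gamma_kernel a 1 x.
Proof. by rewrite /gamma_pdf /gamma_kernel; case: ifP; rewrite ?mulr0// mul1r. Qed.

Lemma Gamma_fun_ge0 a : 0 <= Gamma_fun a.
Proof. by apply: Rintegral_ge0 => x _; rewrite mulr_ge0 ?powR_ge0 ?expR_ge0. Qed.

(** The substitution [u = x v] pulls all dependence on [x] out of the integral: the exponentials
    multiply to [e^(- b x)] and the powers to [x^(a1 + a2 - 1)]. What remains, [K], is the Beta
    integral. It is left in the extended reals; finiteness of the resulting constant will follow
    from total mass one. *)
Lemma gamma_kernel_conv a1 a2 b : exists2 K : \bar R, (0 <= K)%E &
  forall x, (\int[mu]_u (gamma_kernel a2 b (x - u) * gamma_kernel a1 b u)%:E =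
    K * (gamma_kernel (a1 + a2) b x)%:E)%E.
Proof.
exists (\int[mu]_v (gamma_kernel a2 0 (1 - v) * gamma_kernel a1 0 v)%:E)%E.
  by apply: integral_ge0 => v _; rewrite lee_fin mulr_ge0 ?gamma_kernel_ge0.
move=> x; have [x0|x0] := ltP 0 x; last first.
  rewrite /gamma_kernel (ltNge 0 x) x0/= mule0 integral0_eq// => u _.
  rewrite subr_gt0; case: ifPn => [ux|]; last by rewrite mul0r.
  by rewrite ifF ?mulr0//; apply/negbTE; rewrite -leNgt (le_trans (ltW ux)).
pose h u := (gamma_kernel a2 b (x - u) * gamma_kernel a1 b u)%:E.
have mk c : measurable_fun setT (fun v : R => (gamma_kernel a2 c (1 - v) * gamma_kernel a1 c v)%:E).
  apply/measurable_EFinP/measurable_funM; last exact: measurable_gamma_kernel.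
  apply: measurableT_comp; first exact: measurable_gamma_kernel.
  exact: measurable_funB.
have mh : measurable_fun setT h.
  apply/measurable_EFinP/measurable_funM; last exact: measurable_gamma_kernel.
  apply: measurableT_comp; first exact: measurable_gamma_kernel.
  exact: measurable_funB.
have h0 u : (0 <= h u)%E by rewrite lee_fin mulr_ge0 ?gamma_kernel_ge0.
have := ge0_integral_affine x 0 h x0 mh h0.
move=> /(congr1 (fun y => x%:E * y)%E).
rewrite muleA -EFinM divff ?gt_eqF// mul1e => <-.
rewrite -ge0_integralZl//; last 2 first.
- by apply: measurableT_comp => //; apply: measurable_funD => //; exact: measurable_funM.
- exact: ltW.
rewrite muleC -ge0_integralZl//; last 3 first.
- exact: mk.
- by move=> v _; rewrite lee_fin mulr_ge0 ?gamma_kernel_ge0.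
- by rewrite lee_fin gamma_kernel_ge0.
apply: eq_integral => v _; rewrite /h addr0 -!EFinM; congr EFin.
rewrite (_ : x - x * v = x * (1 - v)); last by rewrite mulrBr mulr1.
rewrite !gamma_kernel_scale// {3}/gamma_kernel x0.
have [v0|v0] := ltP 0 v; last by rewrite /gamma_kernel (ltNge 0 v) v0/= !mulr0.
have [v1|v1] := ltP 0 (1 - v); last by rewrite /gamma_kernel (ltNge 0 (1 - v)) v1/= !(mulr0, mul0r).
rewrite /gamma_kernel v0 v1 !mul0r oppr0 expR0 !mulr1.
(* The single factor [x] is the Jacobian; the other two powers come from the two kernels. *)
have -> : x `^ (a1 + a2 - 1) = x * x `^ (a1 - 1) * x `^ (a2 - 1).
  rewrite -{2}(powRr1 (ltW x0)) -!powRD; last 2 first.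
  - by rewrite (gt_eqF x0) implybT.
  - by rewrite (gt_eqF x0) implybT.
  by congr (_ `^ _); ring.
have -> : expR (- (b * x)) = expR (- (b * x * (1 - v))) * expR (- (b * x * v)).
  by rewrite -expRD; congr expR; ring.
ring.
Qed.

End gamma_kernel.

Section gamma_density.
Context {d} {T : measurableType d} {R : realType}.
Variable P : probability T R.
Local Notation mu := (@lebesgue_measure R).

Lemma is_density_gamma_sum (U V : T -> R) (a1 a2 b c1 c2 : R) :
  0 <= c1 -> 0 <= c2 ->
  measurable_fun setT U -> measurable_fun setT V -> indep_pair P U V ->
  is_density P U (fun x => c1 * gamma_kernel a1 b x) ->
  is_density P V (fun x => c2 * gamma_kernel a2 b x) ->
  exists2 c, 0 <= c &
    is_density P (fun t => U t + V t) (fun x => c * gamma_kernel (a1 + a2) b x).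
Proof.
move=> c10 c20 mU mV UV Uf Vf.
have [K K0 conv] := gamma_kernel_conv a1 a2 b.
have := indep_pair_sum_law P U V _ mU mV UV Vf.
have := integral_density_sum P U V _ mU mV UV Vf.
set F := fun x => (\int[P]_t _)%E.
have mk a : measurable_fun setT (fun x => (gamma_kernel a b x)%:E).
  by apply/measurable_EFinP; exact: measurable_gamma_kernel.
have FE x : F x = ((c1 * c2)%:E * K * (gamma_kernel (a1 + a2) b x)%:E)%E.
  rewrite /F (is_density_ge0_integral P U _ mU Uf
    (fun u => (c2 * gamma_kernel a2 b (x - u))%:E)); last 2 first.
  - apply/measurable_EFinP/measurable_funM => //.
    apply: measurableT_comp; first exact: measurable_gamma_kernel.
    exact: measurable_funB.
  - by move=> u; rewrite lee_fin mulr_ge0 ?gamma_kernel_ge0.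
  rewrite -muleA -conv -ge0_integralZl//; last 3 first.
  - apply/measurable_EFinP/measurable_funM; last exact: measurable_gamma_kernel.
    apply: measurableT_comp; first exact: measurable_gamma_kernel.
    exact: measurable_funB.
  - by move=> u _; rewrite lee_fin mulr_ge0 ?gamma_kernel_ge0.
  - by rewrite lee_fin mulr_ge0.
  by apply: eq_integral => u _; rewrite -!EFinM; congr EFin; ring.
move=> F1 FA.
have cK0 : (0 <= (c1 * c2)%:E * K)%E by rewrite mule_ge0// lee_fin mulr_ge0.
have cKfin : ((c1 * c2)%:E * K)%E \is a fin_num.
  (* An infinite constant would give [F] the total mass [0] or [+oo], according to whether the
     kernel has mass zero, whereas this mass is [1]. *)
  rewrite ge0_fin_numE// ltey; apply/eqP => cKy.
  have : (\int[mu]_x F x = 1)%E := F1.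
  under eq_integral do rewrite FE cKy.
  rewrite ge0_integralZl//; last 2 first.
  - exact: mk.
  - by move=> x _; rewrite lee_fin gamma_kernel_ge0.
  set I := (\int[mu]_x _)%E.
  have I0 : (0 <= I)%E.
    by apply: integral_ge0 => x _; rewrite lee_fin gamma_kernel_ge0.
  move: I0; rewrite le_eqVlt => /predU1P[<-|I0].
    by rewrite mule0 => /eqP; rewrite eqe eq_sym oner_eq0.
  by rewrite gt0_mulye.
exists (fine ((c1 * c2)%:E * K)); first exact: fine_ge0.
split; first by apply: measurable_funM => //; exact: measurable_gamma_kernel.
split; first by move=> x; rewrite mulr_ge0 ?fine_ge0 ?gamma_kernel_ge0.
by move=> A mA; rewrite FA//; apply: eq_integral => x _; rewrite -/(F x) FE [RHS]EFinM fineK.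
Qed.

Lemma is_density_gamma_scale (X : T -> R) (a c : R) : 0 < c ->
  is_density P X (gamma_pdf a) -> exists2 k, 0 <= k &
    is_density P (fun t => c * X t) (fun x => k * gamma_kernel a c^-1 x).
Proof.
move=> c0 Xf.
exists (c^-1 * ((Gamma_fun a)^-1 * c^-1 `^ (a - 1))).
  by rewrite !mulr_ge0 ?invr_ge0 ?powR_ge0 ?Gamma_fun_ge0// ltW.
rewrite (_ : (fun x => _) = fun x => c^-1 * gamma_pdf a (c^-1 * x)).
  exact: is_density_scale.
apply/funext => x; rewrite gamma_pdfE gamma_kernel_scale ?invr_gt0// mul1r.
by rewrite !mulrA.
Qed.

(** The factor [e^(- t x)] changes the rate from [1] to [1 + t], which rescales the same density, so
    total mass one yields the transform without any value of [Gamma_fun]. Negative [t > -1] are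
    included for the sake of an exponential moment. *)
Lemma gamma_laplace (X : T -> R) (a t : R) : measurable_fun setT X ->
  is_density P X (gamma_pdf a) -> 0 < 1 + t ->
  (\int[P]_w (expR (- (t * X w)))%:E = ((1 + t) `^ (- a))%:E)%E.
Proof.
move=> mX Xf t0.
have [mp [p0 _]] := Xf.
rewrite (is_density_ge0_integral P X _ mX Xf (fun x => (expR (- (t * x)))%:E)); last 2 first.
- apply/measurable_EFinP; do 2! apply: measurableT_comp => //.
- by move=> x; rewrite lee_fin expR_ge0.
have mp' : measurable_fun setT (fun x => (gamma_pdf a ((1 + t) * x + 0))%:E).
  apply/measurable_EFinP; apply: measurableT_comp => //.
  by apply: measurable_funD => //; exact: measurable_funM.
transitivity (\int[mu]_x (((1 + t) `^ (- (a - 1)))%:E *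
    (gamma_pdf a ((1 + t) * x + 0)%R)%:E))%E.
  apply: eq_integral => x _; rewrite addr0 -!EFinM !gamma_pdfE; congr EFin.
  rewrite gamma_kernel_scale// mul1r mulrCA (mulrCA _ (Gamma_fun a)^-1).
  congr (_ * _); rewrite mulrA -powRD; last by rewrite (gt_eqF t0) implybT.
  rewrite addNr powRr0 mul1r /gamma_kernel; case: ifPn => _; last by rewrite mulr0.
  by rewrite mulrCA -expRD; congr (_ * expR _); ring.
rewrite ge0_integralZl//; last 2 first.
- by move=> x _; rewrite lee_fin.
- by rewrite lee_fin powR_ge0.
rewrite (ge0_integral_affine _ _ (fun x => (gamma_pdf a x)%:E))//; last first.
  exact/measurable_EFinP.
rewrite (is_density_integral1 _ _ _ Xf) mule1 -EFinM -[X in _ * X]powR_inv1 ?ltW//.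
by rewrite -powRD ?(gt_eqF t0) ?implybT//; congr EFin; congr (_ `^ _); ring.
Qed.

Lemma partial_sum_laplace (n : nat) (X : 'I_n -> T -> R) (c : 'I_n -> R)
    (a t : R) :
  (forall i, measurable_fun setT (X i)) -> mutually_independent P X ->
  (forall i, is_density P (X i) (gamma_pdf a)) ->
  0 <= t -> (forall i, 0 <= c i) ->
  (\int[P]_w (expR (- (t * \sum_(i < n) c i * X i w)))%:E =
   (\prod_(i < n) (1 + t * c i) `^ (- a))%:E)%E.
Proof.
move=> mX indX Xf t0 c0.
suff: forall k, (k <= n)%N -> (\int[P]_w (expR (- (t * partial_sum c X k w)))%:E =
    (\prod_(i < n | (i < k)%N) (1 + t * c i) `^ (- a))%:E)%E.
  move=> /(_ n (leqnn n)).
  under eq_integral do rewrite partial_sum_full.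
  by move=> ->; congr EFin; apply: eq_bigl => i; rewrite ltn_ord.
elim => [_|k IH kn].
  under eq_integral do rewrite partial_sum0 mulr0 oppr0 expR0.
  by rewrite integral_cst//= mul1e probability_setT big_pred0.
pose j := Ordinal kn.
have mS := measurable_partial_sum n X c mX k.
have SX := partial_sum_indep P n X c mX indX j.
have mE (s : R) (W : T -> R) : measurable_fun setT W ->
    measurable_fun setT (fun w => (expR (- (s * W w)))%:E).
  move=> mW; apply/measurable_EFinP; do 2! apply: measurableT_comp => //.
  exact: measurable_funM.
transitivity (\int[P]_w \int[P]_v ((expR (- (t * partial_sum c X k w)))%:E *
    (expR (- (t * c j * X j v)))%:E))%E.
  have /= <- := indep_pair_ge0_integral P _ _ (fun x : R * R =>
    (expR (- (t * x.1))%R)%:E * (expR (- (t * c j * x.2))%R)%:E)%E mS (mX j) SX.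
  - apply: eq_integral => w _; rewrite (partial_sumS c X j) -EFinM -expRD.
    by congr (expR _)%:E; rewrite /=; ring.
  - by apply: emeasurable_funM; apply/measurable_EFinP;
      do 2! apply: measurableT_comp => //; exact: measurable_funM.
  - by move=> x; rewrite mule_ge0// lee_fin expR_ge0.
transitivity (\int[P]_w (((1 + t * c j) `^ (- a))%:E *
    (expR (- (t * partial_sum c X k w)))%:E))%E.
  apply: eq_integral => w _; rewrite ge0_integralZl//; last exact: mE.
  by rewrite (gamma_laplace _ a) 1?muleC// ltr_wpDr// mulr_ge0.
rewrite ge0_integralZl//; last 2 first.
- exact: mE.
- by rewrite lee_fin powR_ge0.
rewrite IH 1?ltnW// -EFinM; congr EFin; rewrite [in RHS](bigD1 j)//=.
congr (_ * _); apply: eq_bigl => i; rewrite ltnS -val_eqE /=.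
by case: (ltngtP i k).
Qed.

Lemma exists_density_partial_sum (n : nat) (X : 'I_n -> T -> R)
    (c : 'I_n -> R) (p : 'I_n -> R -> R) :
  (forall i, measurable_fun setT (X i)) -> mutually_independent P X ->
  (forall i, is_density P (X i) (p i)) -> (forall i, 0 <= c i) ->
  (exists i, 0 < c i) ->
  exists f, is_density P (fun t => \sum_(i < n) c i * X i t) f.
Proof.
move=> mX indX Xp c0 [i0 ci0].
suff: forall k, (k <= n)%N -> (exists i : 'I_n, (i < k)%N && (0 < c i)) ->
    exists f, is_density P (partial_sum c X k) f.
  move=> /(_ n (leqnn n)); rewrite (_ : partial_sum c X n =
      fun t => \sum_(i < n) c i * X i t).
    by apply; exists i0; rewrite ltn_ord.
  by apply/funext => t; exact: partial_sum_full.
elim => [_ [i /andP[]]//|k IH kn [i /andP[ik ci]]].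
pose j := Ordinal kn.
have SS : partial_sum c X k.+1 = fun t => partial_sum c X k t + c j * X j t.
  by apply/funext => t; exact: (partial_sumS c X j).
rewrite SS.
(* A zero weight leaves the sum unchanged, and the positive weight then lies among the earlier
   indices. A positive weight provides a density whatever the law of the partial sum. *)
have [cj|cj] := eqVneq (c j) 0.
  have [|f Sf] := IH (ltnW kn).
    exists i; rewrite ci andbT ltn_neqAle -ltnS ik andbT.
    by apply: contraTneq ci => ik'; rewrite (_ : i = j) ?cj ?ltxx//; exact: val_inj.
  exists f; rewrite (_ : (fun _ => _) = partial_sum c X k)//.
  by apply/funext => t; rewrite cj mul0r addr0.
have cj0 : 0 < c j by rewrite lt_neqAle eq_sym cj c0.
have cXp := is_density_scale P _ _ _ cj0 (Xp j).
have mcX : measurable_fun setT (fun t => c j * X j t) by exact: measurable_funM.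
have Scx : indep_pair P (partial_sum c X k) (fun t => c j * X j t).
  move=> A B mA mB.
  have mB' : measurable [set x | B (c j * x)].
    have mc : measurable_fun setT (fun x : R => c j * x) by exact: measurable_funM.
    by rewrite -[Y in measurable Y]setTI; exact: mc.
  exact: (partial_sum_indep P n X c mX indX j A _ mA mB').
exists (fine \o (fun x => \int[P]_t ((c j)^-1 * p j ((c j)^-1 * (x - partial_sum c X k t)))%:E)%E).
exact: (is_density_sum P _ _ _ (measurable_partial_sum n X c mX k) mcX Scx cXp).
Qed.

Lemma is_density_gamma_equal_sum (n : nat) (X : 'I_n -> T -> R) (a b : R) :
  (forall i, measurable_fun setT (X i)) -> mutually_independent P X ->
  (forall i, is_density P (X i) (gamma_pdf a)) -> (0 < n)%N -> 0 < b ->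
  exists2 k, 0 <= k & is_density P (fun t => b^-1 * \sum_(i < n) X i t)
    (fun x => k * gamma_kernel (n%:R * a) b x).
Proof.
move=> mX indX Xa n0 b0.
pose c (_ : 'I_n) := b^-1.
(* The induction starts with one term: the empty sum is the constant [0], which has no density. *)
suff: forall k, (k < n)%N -> exists2 K, 0 <= K &
    is_density P (partial_sum c X k.+1) (fun x => K * gamma_kernel (k.+1%:R * a) b x).
  move=> /(_ n.-1); rewrite prednK// => /(_ (leqnn n))[K K0 Sf].
  exists K => //; rewrite (_ : (fun _ => _) = partial_sum c X n)//.
  by apply/funext => t; rewrite partial_sum_full mulr_sumr.
have bXa (j : 'I_n) := is_density_gamma_scale (X j) a b^-1.
elim => [|k IH] kn.
  have [||K K0] := bXa (Ordinal kn); rewrite ?invr_gt0// invrK => Xf.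
  exists K => //; rewrite mul1r (_ : partial_sum c X 1 = (fun t => b^-1 * X (Ordinal kn) t))//.
  by apply/funext => t; rewrite (partial_sumS c X (Ordinal kn)) partial_sum0 add0r.
have [K K0 Sf] := IH (ltnW kn).
pose j := Ordinal kn.
have [||K' K'0] := bXa j; rewrite ?invr_gt0// invrK => Xf.
have SS : partial_sum c X k.+2 = fun t => partial_sum c X k.+1 t + b^-1 * X j t.
  by apply/funext => t; exact: (partial_sumS c X j).
have mcX : measurable_fun setT (fun t => b^-1 * X j t) by exact: measurable_funM.
have Scx : indep_pair P (partial_sum c X k.+1) (fun t => b^-1 * X j t).
  move=> A B mA mB.
  have mB' : measurable [set x | B (b^-1 * x)].
    have mc : measurable_fun setT (fun x : R => b^-1 * x) by exact: measurable_funM.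
    by rewrite -[Y in measurable Y]setTI; exact: mc.
  exact: (partial_sum_indep P n X c mX indX j A _ mA mB').
have [L L0] := is_density_gamma_sum _ _ _ _ _ _ _ K0 K'0
  (measurable_partial_sum n X c mX k.+1) mcX Scx Sf Xf.
rewrite -SS (_ : k.+1%:R * a + a = k.+2%:R * a); last first.
  by rewrite -[in RHS]natr1 mulrDl mul1r.
by exists L.
Qed.

End gamma_density.

(** * The Laplace transform inequality *)

Section real_inequalities.
Context {R : realType}.
Implicit Types a b m t x y : R.

Lemma ln_le_sub1 x : 0 < x -> ln x <= x - 1.
Proof.
move=> x0; have := @le_ln1Dx R (x - 1).
rewrite (_ : 1 + (x - 1) = x); last by ring.
by apply; lra.
Qed.

(* The concavity of [u |-> sqrt u - ln (1 + sqrt u)], written as its tangent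
   line inequality at [u = y ^+ 2]. *)
Lemma sub_ln1D_tangent x y : 0 <= x -> 0 <= y ->
  x - ln (1 + x) <= y - ln (1 + y) + (x ^+ 2 - y ^+ 2) / (2 * (1 + y)).
Proof.
move=> x0 y0.
pose G (z : R) : R := z - ln (1 + z) - (2 * (1 + y))^-1 * z ^+ 2.
pose dG (z : R) : R := 1 - (1 + z)^-1 - z / (1 + y).
have GdG (z : R) : 0 <= z -> is_derive z (1 : R) G (dG z).
  move=> z0; have z1 : 0 < 1 + z by rewrite ltr_pwDl.
  have y1 : 1 + y != 0 by rewrite gt_eqF// ltr_pwDl.
  have d1 : is_derive z (1 : R) (fun z : R => 1 + z) (0 + 1).
    exact (is_deriveD (is_derive_cst (1 : R) z (1 : R)) (is_derive_id z (1 : R))).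
  have dln : is_derive z (1 : R) (fun z : R => ln (1 + z)) ((1 + z)^-1 * (0 + 1)).
    exact (@is_derive1_comp R (@ln R) (fun z : R => 1 + z) z _ _ (is_derive1_ln z1) d1).
  have dsq := is_deriveZ (2 * (1 + y))^-1 (is_deriveX 2 (is_derive_id z (1 : R))).
  have dG0 := is_deriveB (is_deriveB (is_derive_id z (1 : R)) dln) dsq.
  apply: (is_derive_eq dG0).
  rewrite /dG /GRing.scale/= expr1 add0r; field.
  by rewrite y1 gt_eqF.
have Gmax u v : 0 <= u -> 0 <= v -> u < v -> exists c, [/\ u < c, c < v &
    G v - G u = dG c * (v - u)].
  move=> u0 v0 uv.
  have [|c|c cuv ->] := @MVT _ G dG u v uv.
  - by move=> z; rewrite in_itv/= => /andP[uz _]; apply: GdG; rewrite (le_trans u0)// ltW.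
  - apply: derivable_within_continuous => z; rewrite in_itv/= => /andP[uz _].
    by have [] := GdG z (le_trans u0 uz).
  - by exists c; move: cuv; rewrite in_itv/= => /andP[].
(* In this factored form the derivative has the sign of [y - c], so [G] is maximal at [y]. *)
have dGE c : 0 <= c -> dG c = c * (y - c) / ((1 + c) * (1 + y)).
  move=> c0; rewrite /dG; field.
  by rewrite !gt_eqF// ltr_pwDl.
suff : G x <= G y.
  by rewrite /G => Gxy; rewrite mulrBl; lra.
have [xy|yx|->//] := ltgtP x y.
- have [c [xc cy Gc]] := Gmax x y x0 y0 xy.
  rewrite -subr_ge0 Gc dGE; last by rewrite (le_trans x0)// ltW.
  have c0 : 0 <= c by rewrite (le_trans x0)// ltW.
  by rewrite !mulr_ge0 ?invr_ge0 ?mulr_ge0 ?subr_ge0 ?addr_ge0// ltW.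
- have [c [yc cx Gc]] := Gmax y x y0 x0 yx.
  have c0 : 0 <= c by rewrite (le_trans y0)// ltW.
  rewrite -subr_ge0 (_ : G y - G x =
    c * (c - y) / ((1 + c) * (1 + y)) * (x - y)); last first.
    by rewrite -opprB Gc dGE//; ring.
  by rewrite !mulr_ge0 ?invr_ge0 ?mulr_ge0 ?subr_ge0 ?addr_ge0// ltW.
Qed.

(** After taking logarithms, this is the tangent inequality at [t / sqrt n] summed over [i]. The
    linear terms cancel, because both the squares [(t c i)^2] and the [n] copies of [(t / sqrt n)^2]
    sum to [t^2]. As [sqrt n] is at least the sum of the [c i], replacing [m] by the smaller [a] in
    the shift only weakens the factor. *)
Lemma laplace_product_le (n : nat) (c : 'I_n -> R) a m t :
  (0 < n)%N -> 0 < a -> a <= m -> 0 <= t -> (forall i, 0 <= c i) ->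
  \sum_(i < n) c i ^+ 2 = 1 -> \sum_(i < n) c i <= Num.sqrt n%:R ->
  expR (- (t * (m * (Num.sqrt n%:R - \sum_(i < n) c i)))) *
    \prod_(i < n) (1 + t * c i) `^ (- a) <=
  \prod_(i < n) (1 + t * (Num.sqrt n%:R)^-1) `^ (- a).
Proof.
move=> n0 a0 am t0 c0 c21 cb.
set b := Num.sqrt n%:R; set s := \sum_(i < n) c i.
have b0 : 0 < b by rewrite sqrtr_gt0 ltr0n.
have bn : n%:R = b * b by rewrite -expr2 sqr_sqrtr.
have powE u : 0 <= u -> (1 + u) `^ (- a) = expR (- a * ln (1 + u)).
  by move=> u0; rewrite /powR gt_eqF// ltr_pwDl.
have tb0 : 0 <= t * b^-1 by rewrite mulr_ge0// invr_ge0 ltW.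
rewrite (eq_bigr (fun i => expR (- a * ln (1 + t * c i)))); last first.
  by move=> i _; rewrite powE// mulr_ge0.
rewrite powE// -!expR_sum -expRD ler_expR -!mulr_sumr.
have : \sum_(i < n) (t * c i - ln (1 + t * c i)) <=
    \sum_(i < n) (t * b^-1 - ln (1 + t * b^-1) +
      ((t * c i) ^+ 2 - (t * b^-1) ^+ 2) / (2 * (1 + t * b^-1))).
  by apply: ler_sum => i _; apply: sub_ln1D_tangent => //; rewrite mulr_ge0.
rewrite [X in _ <= X]big_split/= -mulr_suml.
under [X in _ <= _ + X / _]eq_bigr do rewrite !exprMn -mulrBr.
rewrite -mulr_sumr !sumrB c21 -mulr_sumr -/s !sumr_const card_ord.
have -> : b^-1 ^+ 2 *+ n = 1.
  by rewrite -[LHS]mulr_natr bn; field; rewrite gt_eqF.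
have -> : t * b^-1 *+ n = t * b.
  by rewrite -[LHS]mulr_natr bn; field; rewrite gt_eqF.
rewrite subrr mulr0 mul0r addr0 => L.
set A := \sum_(i < n) ln _ in L *; set B := ln _ *+ n in L *.
have h1 : a * (t * (b - s)) <= m * (t * (b - s)).
  by rewrite ler_wpM2r// mulr_ge0// subr_ge0.
have h2 : a * (t * s - A) <= a * (t * b - B) by rewrite ler_pM2l.
by lra.
Qed.

End real_inequalities.

(** * Integrability and mean of the gamma law *)

Section gamma_mean.
Context {d} {T : measurableType d} {R : realType}.
Variables (P : probability T R) (X : T -> R) (a : R).
Hypotheses (a0 : 0 < a) (mX : measurable_fun setT X) (X0 : forall t, 0 < X t)
  (Xa : is_density P X (gamma_pdf a)).

(** The Laplace transform at [- 1 / 2] is a finite exponential moment, and [X <= 2 e^(X / 2)]. *)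
Lemma gamma_integrable : P.-integrable setT (EFin \o X).
Proof.
have hpos : 0 < 1 + - 2^-1 :> R by lra.
have E := gamma_laplace P X a _ mX Xa hpos.
have iE : P.-integrable setT (fun w => (2 * expR (- (- 2^-1 * X w)))%:E).
  under eq_fun do rewrite EFinM.
  apply: integrableZl => //; apply/integrableP; split.
    apply/measurable_EFinP; do 2! apply: measurableT_comp => //.
    exact: measurable_funM.
  under eq_integral do rewrite /= ger0_norm ?expR_ge0//.
  by rewrite E ltry.
apply: le_integrable iE => //; first exact/measurable_EFinP.
move=> w _ /=; rewrite lee_fin !ger0_norm ?mulr_ge0 ?expR_ge0 1?ltW//.
have := expR_ge1Dx (- (- 2^-1 * X w)); lra.
Qed.

(** Integrating [1 - t X <= e^(- t X)] gives [1 - t m <= (1 + t)^(- a)]; comparing first-order terms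
    at [t = 0] yields the bound. *)
Lemma gamma_mean_ge m : (\int[P]_w (X w)%:E = m%:E)%E -> a <= m.
Proof.
move=> EX.
(* A quantitative form of the limit [t -> 0]: with [v = a ln (1 + t)], it combines
   [v >= a t / (1 + t)] and [e^(- v) <= 1 / (1 + v)]. *)
have bound t : 0 < t -> a <= m * (1 + t * (1 + a)).
  move=> t0; have t1 : 0 < 1 + t by rewrite ltr_pwDl// ltW.
  have tX : P.-integrable setT (fun w => (t * X w)%:E).
    exact: integrable_EFinZ gamma_integrable.
  have i1 : P.-integrable setT (fun w => (1 - t * X w)%:E).
    exact: integrable_EFinB (integrable_EFin_cst P 1) tX.
  have : (\int[P]_w (1 - t * X w)%:E <= \int[P]_w (expR (- (t * X w)))%:E)%E.
    apply: le_integral => //; last first.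
      by move=> w _; rewrite lee_fin; exact: expR_ge1Dx.
    apply/integrableP; split.
      apply/measurable_EFinP; do 2! apply: measurableT_comp => //.
      exact: measurable_funM.
    under eq_integral do rewrite /= ger0_norm ?expR_ge0//.
    by rewrite (gamma_laplace P X a)// ltry.
  rewrite (gamma_laplace P X a)//.
  rewrite integral_EFinB ?integral_EFin_cst//; last exact: integrable_EFin_cst.
  rewrite integral_EFinZ; last exact: gamma_integrable.
  rewrite EX -EFinM -EFinB lee_fin /powR gt_eqF// => le1.
  set v := a * ln (1 + t).
  have v_ge : a * t <= v * (1 + t).
    rewrite -mulrA ler_pM2l//.
    have l1 : - ln (1 + t) <= (1 + t)^-1 - 1.
      by rewrite -lnV ?posrE// ln_le_sub1 ?invr_gt0.
    have := ler_wpM2r (ltW t1) l1.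
    by rewrite mulrBl mulVf ?gt_eqF//; lra.
  have v0 : 0 < v.
    by rewrite -(pmulr_lgt0 _ t1) (lt_le_trans _ v_ge)// mulr_gt0.
  have ev : expR (- v) * (1 + v) <= 1.
    apply: (@le_trans _ _ (expR (- v) * expR v)).
      by rewrite ler_pM2l ?expR_gt0// expR_ge1Dx.
    by rewrite -expRD addNr expR0.
  move: le1; rewrite mulNr -/v => le1.
  have le2 : (1 - t * m) * (1 + v) <= 1.
    by rewrite (le_trans _ ev)// ler_pM2r// ltr_pwDl// ltW.
  have v_tm : v <= t * m * (1 + v) by lra.
  have tm1 : t * m < 1 -> a * t * (1 - t * m) <= t * m * (1 + t).
    move=> tm1; apply: (@le_trans _ _ (v * (1 + t) * (1 - t * m))).
      by rewrite ler_pM2r// subr_gt0.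
    by rewrite mulrAC ler_pM2r//; lra.
  have [{}/tm1 tm1|tm1'] := ltP (t * m) 1.
    by rewrite -(ler_pM2l t0); lra.
  have at0 : 0 <= a * t * (t * m - 1) by rewrite !mulr_ge0 ?subr_ge0// ltW.
  have tt0 : 0 <= t * (t * m) by rewrite mulr_ge0 ?(ltW t0)// (le_trans ler01).
  by rewrite -(ler_pM2l t0); lra.
rewrite leNgt; apply/negP => ma.
have [m0|m0] := leP m 0.
  have := bound 1 ltr01; rewrite mul1r => am.
  have a2 : 0 <= 1 + (1 + a) by move: a0; lra.
  by have := mulr_le0_ge0 m0 a2; move: a0; lra.
have ne : 2 * (1 + a) * m != 0 by rewrite gt_eqF// !mulr_gt0// ltr_pwDl// ltW.
(* With this [t] the bound reads [a <= m + (a - m) / 2], against [m < a]. *)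
have := bound ((a - m) / (2 * (1 + a) * m)).
rewrite divr_gt0 ?subr_gt0// ?mulr_gt0//; last by move: a0; lra.
move=> /(_ isT).
have -> : m * (1 + (a - m) / (2 * (1 + a) * m) * (1 + a)) = m + (a - m) / 2.
  by field; rewrite !gt_eqF//; move: a0; lra.
lra.
Qed.

End gamma_mean.

(** * From Laplace transforms to logarithms *)

Section log_laplace.
Context {R : realType}.
Implicit Types M x y s u w : R.
Local Notation mu := (@lebesgue_measure R).

Lemma integral_expRN y : 0 < y ->
  (\int[mu]_u (\1_`[0, +oo[ u * expR (- (u * y)))%:E = (y^-1)%:E)%E.
Proof.
move=> y0.
transitivity (\int[mu]_u (y^-1 * exponential_pdf y u)%:E)%E.
  apply: eq_integral => u _; congr EFin.
  rewrite /exponential_pdf patchE indicE; case: ifPn => _; last first.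
    by rewrite mul0r mulr0.
  by rewrite mul1r mulrA mulVf ?gt_eqF// mul1r mulNr mulrC.
rewrite integral_EFinZ; last exact: integrable_exponential_pdf.
by rewrite integral_exponential_pdf// mule1.
Qed.

Lemma integral_invD M x : 0 < M -> 0 < x ->
  (\int[mu]_(s in `[0%R, M]) ((s + x)^-1)%:E = (ln (M + x) - ln x)%:E)%E.
Proof.
move=> M0 x0.
have sx0 s : 0 <= s -> 0 < s + x by move=> s0; rewrite ltr_wpDl.
have d1 s : 0 <= s -> is_derive s (1 : R) (fun s : R => ln (s + x)) ((s + x)^-1).
  move=> s0.
  have dsx : is_derive s (1 : R) (fun s : R => s + x) (1 + 0).
    exact (is_deriveD (is_derive_id s (1 : R)) (is_derive_cst x s (1 : R))).
  have dl := @is_derive1_comp R (@ln R) (fun s : R => s + x) s _ _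
    (is_derive1_ln (sx0 s s0)) dsx.
  by apply: (is_derive_eq dl); rewrite addr0 mulr1.
have cln s : 0 <= s -> {for s, continuous (fun s : R => ln (s + x))}.
  move=> s0; apply: differentiable_continuous.
  by apply/derivable1_diffP; have [] := d1 s s0.
rewrite (@continuous_FTC2 _ _ (fun s : R => ln (s + x))) ?add0r ?EFinB//.
- apply: continuous_in_subspaceT => s; rewrite inE/= in_itv/= => /andP[s0 _].
  apply: (@continuousV _ _ (fun s : R => s + x)); first by rewrite gt_eqF// sx0.
  by apply: continuousD; [exact: cvg_id|exact: cvg_cst].
- split.
  + by move=> s; rewrite in_itv/= => /andP[s0 _]; have [] := d1 s (ltW s0).
  + by apply: cvg_at_right_filter; exact: cln.
  + by apply: cvg_at_left_filter; apply: cln; exact: ltW.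
- move=> s; rewrite in_itv/= => /andP[s0 _].
  by rewrite derive1E; have [_ ->] := d1 s (ltW s0).
Qed.

Lemma log_double_integral M w : 0 < M -> 0 < w ->
  (\int[mu]_s \int[mu]_u (\1_`[0, M] s *
     (\1_`[0, +oo[ u * expR (- (u * (s + w)))))%:E =
   (ln (M + w) - ln w)%:E)%E.
Proof.
move=> M0 w0.
rewrite -integral_invD// [RHS]integral_indicM//; apply: eq_integral => s _.
under eq_integral do rewrite EFinM.
rewrite ge0_integralZl//; last first.
  apply/measurable_EFinP/measurable_funM => //.
  by do 2! apply: measurableT_comp => //; exact: measurable_funM.
rewrite indicE; have [|] := boolP (s \in _); last by rewrite !mul0e.
rewrite inE/= in_itv/= => /andP[s0 _].
by rewrite integral_expRN// ltr_wpDl.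
Qed.

End log_laplace.

Section log_comparison.
Context {d} {T : measurableType d} {R : realType}.
Variable P : probability T R.
Local Notation mu := (@lebesgue_measure R).

(** Every factor is nonnegative, so Tonelli applies whether or not the logarithm is integrable, and
    [e^(- u (s + W))] splits into a weight in [(s, u)] times the integrand of the Laplace transform.
    As the weight is nonnegative, an inequality between transforms survives the integration. *)
Lemma integral_ln_laplace (W : T -> R) (M : R) : 0 < M ->
  measurable_fun setT W -> (forall t, 0 < W t) ->
  (\int[P]_t (ln (M + W t) - ln (W t))%:E =
   \int[mu]_s \int[mu]_u ((\1_`[0, M] s * (\1_`[0, +oo[ u *
      expR (- (u * s))))%:E * \int[P]_t (expR (- (u * W t)))%:E))%E.
Proof.
move=> M0 mW W0.
pose G (tsu : T * R * R) : \bar R := (\1_`[0, M] tsu.1.2 *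
  (\1_`[0, +oo[ tsu.2 * expR (- (tsu.2 * (tsu.1.2 + W tsu.1.1)))))%:E.
have mG : measurable_fun setT G.
  have m1 : measurable_fun setT (fun tsu : T * R * R => tsu.1.2).
    exact: (measurableT_comp measurable_snd).
  have mW1 : measurable_fun setT (fun tsu : T * R * R => W tsu.1.1).
    by apply: (measurableT_comp mW); exact: (measurableT_comp measurable_fst).
  apply/measurable_EFinP/measurable_funM; first exact: (measurableT_comp _ m1).
  apply: measurable_funM; first exact: measurableT_comp.
  do 2! apply: measurableT_comp => //; apply: measurable_funM => //.
  exact: measurable_funD.
have G0 x : (0 <= G x)%E by rewrite lee_fin !mulr_ge0 ?expR_ge0.
transitivity (\int[P]_t \int[mu]_s \int[mu]_u G (t, s, u))%E.
  by apply: eq_integral => t _; rewrite -log_double_integral.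
have mG1 := @measurable_fun_fubini_tonelli_F _ _ (T * R)%type _ R mu G mG G0.
rewrite (@fubini_tonelli _ _ _ _ _ P mu (fun ts => \int[mu]_u G (ts, u))%E mG1);
  last by move=> ts; apply: integral_ge0.
apply: eq_integral => s _.
have mGs : measurable_fun setT (fun tu : T * R => G (tu.1, s, tu.2)).
  apply: (measurableT_comp mG); apply/measurable_fun_pair => //.
  exact/measurable_fun_pair.
rewrite (@fubini_tonelli _ _ _ _ _ P mu (fun tu => G (tu.1, s, tu.2)) mGs)//.
apply: eq_integral => u _; rewrite -ge0_integralZl//; last first.
  apply/measurable_EFinP; do 2! apply: measurableT_comp => //.
  exact: measurable_funM.
apply: eq_integral => t _; rewrite /G/= -EFinM; congr EFin.
by rewrite mulrDr opprD expRD !mulrA.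
Qed.

Lemma le_integral_ln (W1 W2 : T -> R) (M : R) : 0 < M ->
  measurable_fun setT W1 -> measurable_fun setT W2 ->
  (forall t, 0 < W1 t) -> (forall t, 0 < W2 t) ->
  (forall u : R, (0 <= u)%R -> \int[P]_t (expR (- (u * W1 t)))%:E <=
    \int[P]_t (expR (- (u * W2 t)))%:E)%E ->
  (\int[P]_t (ln (M + W1 t) - ln (W1 t))%:E <=
   \int[P]_t (ln (M + W2 t) - ln (W2 t))%:E)%E.
Proof.
move=> M0 mW1 mW2 W10 W20 L12; rewrite (integral_ln_laplace W1 M M0 mW1 W10) (integral_ln_laplace W2 M M0 mW2 W20).
have mL (W : T -> R) : measurable_fun setT W ->
    measurable_fun setT (fun u : R => \int[P]_t (expR (- (u * W t)))%:E)%E.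
  move=> mW.
  apply: (@measurable_fun_fubini_tonelli_F _ _ R T R P
    (fun ut => (expR (- (ut.1 * W ut.2)))%:E)).
    apply/measurable_EFinP; do 2! apply: measurableT_comp => //.
    by apply: measurable_funM => //; exact: (measurableT_comp mW).
  by move=> x; rewrite lee_fin expR_ge0.
pose K (su : R * R) := (\1_`[0, M] su.1 *
    (\1_`[0, +oo[ su.2 * expR (- (su.2 * su.1))))%:E.
have mK : measurable_fun setT K.
  apply/measurable_EFinP/measurable_funM; first exact: measurableT_comp.
  apply: measurable_funM; first exact: measurableT_comp.
  by do 2! apply: measurableT_comp => //; exact: measurable_funM.
have L0 (W : T -> R) u : (0 <= \int[P]_t (expR (- (u * W t)))%:E)%E.
  by apply: integral_ge0 => t _; rewrite lee_fin expR_ge0.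
have K0 x : (0 <= K x)%E by rewrite lee_fin !mulr_ge0 ?expR_ge0.
have mKL (W : T -> R) : measurable_fun setT W -> measurable_fun setT
    (fun su : R * R => K su * \int[P]_t (expR (- (su.2 * W t)))%:E)%E.
  move=> mW; apply: emeasurable_funM => //.
  exact: (measurableT_comp (mL W mW)).
have mKs (W : T -> R) s : measurable_fun setT W -> measurable_fun setT
    (fun u : R => K (s, u) * \int[P]_t (expR (- (u * W t)))%:E)%E.
  by move=> mW; exact: (measurableT_comp (mKL W mW)).
have mKF (W : T -> R) : measurable_fun setT W -> measurable_fun setT
    (fun s => \int[mu]_u (K (s, u) * \int[P]_t (expR (- (u * W t)))%:E))%E.
  move=> mW.
  apply: (@measurable_fun_fubini_tonelli_F _ _ R _ R mu _ (mKL W mW)).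
  by move=> x; rewrite mule_ge0.
have K12 su : (K su * \int[P]_t (expR (- (su.2 * W1 t)))%:E <=
    K su * \int[P]_t (expR (- (su.2 * W2 t)))%:E)%E.
  rewrite /K !indicE; have [|_] := boolP (su.2 \in _); last first.
    by rewrite mul0r mulr0 !mul0e.
  rewrite inE/= in_itv/= andbT => su0.
  by rewrite lee_wpmul2l ?L12// lee_fin !mulr_ge0 ?expR_ge0.
have KL0 s u : (0 <= K (s, u) * \int[P]_t (expR (- (u * W1 t)))%:E)%E.
  exact: mule_ge0.
exact (ge0_le_integral mu measurableT
  (fun s _ => integral_ge0 mu (fun u _ => KL0 s u)) (mKF W1 mW1) (mKF W2 mW2)
  (fun s _ => ge0_le_integral mu measurableT (fun u _ => KL0 s u)
    (mKs W1 s mW1) (mKs W2 s mW2) (fun u _ => K12 (s, u)))).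
Qed.

(** By [ln M <= ln (M + w) <= ln M + w / M] the terms [ln M] cancel, at the cost of an error
    [k m2 / M] that vanishes for large [M]. The factor [k] stays inside the integrals because
    integrability will be available for [(a - 1) * ln Z] as a whole. *)
Lemma ln_integral_ge (W1 W2 : T -> R) (k : R) : 0 <= k ->
  measurable_fun setT W1 -> measurable_fun setT W2 ->
  (forall t, 0 < W1 t) -> (forall t, 0 < W2 t) ->
  P.-integrable setT (fun t => (W2 t)%:E) ->
  P.-integrable setT (fun t => (k * ln (W1 t))%:E) ->
  P.-integrable setT (fun t => (k * ln (W2 t))%:E) ->
  (forall u : R, (0 <= u)%R -> \int[P]_t (expR (- (u * W1 t)))%:E <=
    \int[P]_t (expR (- (u * W2 t)))%:E)%E ->
  (\int[P]_t (k * ln (W2 t))%:E <= \int[P]_t (k * ln (W1 t))%:E)%E.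
Proof.
move=> k0 mW1 mW2 W10 W20 iW2 i1 i2 L12.
have fin (f : T -> R) : P.-integrable setT (fun t => (f t)%:E) ->
    exists r : R, (\int[P]_t (f t)%:E)%E = r%:E.
  by move=> fi; exists (fine (\int[P]_t (f t)%:E)%E); rewrite fineK//; exact: integrable_fin_num.
have [m2 E2] := fin _ iW2.
have [l1 El1] := fin _ i1; have [l2 El2] := fin _ i2.
have mln (W : T -> R) (M : R) : measurable_fun setT W ->
    measurable_fun setT (fun t => (ln (M + W t) - ln (W t))%:E).
  move=> mW; apply/measurable_EFinP/measurable_funB; last exact: measurableT_comp.
  by apply: measurableT_comp => //; exact: measurable_funD.
have lnD_ge0 M w : 0 < M -> 0 < w -> 0 <= ln (M + w) - ln w.
  by move=> M0 w0; rewrite subr_ge0 ler_ln ?posrE ?lerDr 1?ltW// addr_gt0.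
have key M : 0 < M -> l2 <= l1 + k * M^-1 * m2.
  move=> M0.
  have iM := integrable_EFin_cst P (k * ln M).
  have iMW : P.-integrable setT (fun t => (k * ln M + k * M^-1 * W2 t)%:E).
    exact: integrable_EFinD iM (integrable_EFinZ _ _ iW2).
  have iU : P.-integrable setT (fun t => (k * ln M + k * M^-1 * W2 t - k * ln (W2 t))%:E).
    exact: integrable_EFinB iMW i2.
  have iL : P.-integrable setT (fun t => (k * ln M - k * ln (W1 t))%:E).
    exact: integrable_EFinB iM i1.
  have lnU w : 0 < w -> k * (ln (M + w) - ln w) <= k * ln M + k * M^-1 * w - k * ln w.
    move=> w0; rewrite -mulrA -mulrDr -mulrBr ler_wpM2l// lerD2r.
    have -> : M + w = M * (1 + M^-1 * w) by rewrite mulrDr mulr1 mulVKf ?gt_eqF.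
    have Mw0 : 0 < M^-1 * w by rewrite mulr_gt0// invr_gt0.
    rewrite lnM ?posrE//; last by rewrite addr_gt0.
    by rewrite lerD2l le_ln1Dx// (lt_trans _ Mw0)// ltrN10.
  have i2' : P.-integrable setT (fun t => (k * (ln (M + W2 t) - ln (W2 t)))%:E).
    apply: le_integrable iU => //.
      under eq_fun do rewrite EFinM.
      by apply: emeasurable_funM => //; exact: mln.
    move=> t _ /=; rewrite lee_fin ger0_norm; last by rewrite mulr_ge0// lnD_ge0.
    by rewrite (le_trans (lnU _ (W20 t)))// ler_norm.
  have le12 : (\int[P]_t (k * (ln (M + W1 t) - ln (W1 t)))%:E <=
      \int[P]_t (k * (ln (M + W2 t) - ln (W2 t)))%:E)%E.
    under eq_integral do rewrite EFinM.
    under [leRHS]eq_integral do rewrite EFinM.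
    have ge0 (W : T -> R) t : 0 < W t -> (0 <= (ln (M + W t) - ln (W t))%:E)%E.
      by move=> Wt; rewrite lee_fin lnD_ge0.
    rewrite !ge0_integralZl//; [|exact: mln|by move=> t _; exact: ge0
      |exact: mln|by move=> t _; exact: ge0].
    by apply: lee_wpmul2l; [rewrite lee_fin|exact: le_integral_ln].
  (* [W1] is not assumed integrable: the bound is inherited from [W2] through [le12]. *)
  have i1' : P.-integrable setT (fun t => (k * (ln (M + W1 t) - ln (W1 t)))%:E).
    apply/integrableP; split.
      under eq_fun do rewrite EFinM.
      by apply: emeasurable_funM => //; exact: mln.
    under eq_integral do rewrite /= ger0_norm ?mulr_ge0 ?lnD_ge0//.
    by rewrite (le_lt_trans le12)// integrable_lty.
  have : (\int[P]_t (k * ln M - k * ln (W1 t))%:E <=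
      \int[P]_t (k * ln M + k * M^-1 * W2 t - k * ln (W2 t))%:E)%E.
    apply: (@le_trans _ _ (\int[P]_t (k * (ln (M + W1 t) - ln (W1 t)))%:E)%E).
      apply: le_integral => // t _; rewrite lee_fin -mulrBr ler_wpM2l// lerD2r.
      by rewrite ler_ln ?posrE ?addr_gt0// lerDl ltW.
    apply: (le_trans le12); apply: le_integral => // t _.
    by rewrite lee_fin lnU.
  rewrite (integral_EFinB (fun=> k * ln M) _ iM i1) (integral_EFinB _ _ iMW i2).
  rewrite (integral_EFinD (fun=> k * ln M) _ iM (integrable_EFinZ _ _ iW2)).
  rewrite !integral_EFin_cst El1 El2 integral_EFinZ// E2 -EFinM -EFinD -!EFinB.
  by rewrite lee_fin; lra.
rewrite El1 El2 lee_fin leNgt; apply/negP => l12.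
have [km0|km0] := leP (k * m2) 0.
  by have := key 1 ltr01; rewrite invr1 mulr1; lra.
(* This [M] makes the error equal to half of the supposed gap [l2 - l1]. *)
have M0 : 0 < 2 * (k * m2) / (l2 - l1) by apply: divr_gt0; rewrite ?subr_gt0// mulr_gt0.
have := key _ M0.
have -> : k * (2 * (k * m2) / (l2 - l1))^-1 * m2 = (l2 - l1) / 2.
  rewrite mulrAC; move: km0; set c := k * m2 => c0.
  by field; rewrite !gt_eqF ?subr_gt0.
lra.
Qed.

End log_comparison.

(** * Entropy *)

(* [u] need not be integrable: [+oo - +oo = -oo] for extended reals, so an
   infinite negative part makes the integral [-oo]. *)
Lemma le_integral_integrable {d} {T : measurableType d} {R : realType}
    (mu : {measure set T -> \bar R}) (u h : T -> R) :
  measurable_fun setT u -> mu.-integrable setT (fun x => (h x)%:E) ->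
  (forall x, u x <= h x) ->
  (\int[mu]_x (u x)%:E <= \int[mu]_x (h x)%:E)%E.
Proof.
move=> mu_u hi uh.
have mE : measurable_fun setT (EFin \o u) by exact/measurable_EFinP.
have mp := measurable_funepos mE; have mn := measurable_funeneg mE.
have upos : (\int[mu]_x (EFin \o u)^\+ x < +oo)%E.
  apply: le_lt_trans (integral_funepos_lt_pinfty measurableT hi).
  apply: ge0_le_integral => //.
    by apply: measurable_funepos; case/integrableP : hi.
  move=> x _; rewrite !funeposE /= -!EFin_max lee_fin.
  by rewrite ge_max !le_max uh lexx orbT.
have [uneg|uneg] := ltP (\int[mu]_x (EFin \o u)^\- x)%E +oo%E.
  apply: le_integral => //; last by move=> x _; rewrite lee_fin.
  apply/integrableP; split => //.
  under eq_integral do rewrite -/((abse \o (EFin \o u)) _) fune_abse.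
  by rewrite ge0_integralD// lte_add_pinfty.
rewrite integralE (_ : (\int[mu]_x (EFin \o u)^\- x)%E = +oo%E).
  by rewrite addeNy leNye.
by apply/eqP; rewrite -leye_eq.
Qed.

(** This is [ln r <= r - 1] at [r = g / f]. The term [g - f] is kept because the reference function
    used below has mass less than one, and this missing mass makes the entropy inequality strict. *)
Lemma gibbs_pointwise {R : realType} (f g : R) : 0 <= f -> 0 < g ->
  - xlnx f <= f * - ln g + g - f.
Proof.
move=> f0 g0; rewrite /xlnx; case: eqP => [->|/eqP f_neq0].
  by rewrite oppr0 mul0r add0r addr0 ltW.
have fpos : 0 < f by rewrite lt_neqAle eq_sym f_neq0 f0.
have := ln_le_sub1 _ (divr_gt0 g0 fpos).
rewrite ln_div ?posrE// => /(ler_wpM2l f0).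
by rewrite !mulrBr mulr1 mulrCA divff// mulr1; lra.
Qed.

Lemma is_density_ae {d} {T : measurableType d} {R : realType}
    (P : probability T R) (Y Y' : T -> R) (f : R -> R) :
  measurable_fun setT Y -> measurable_fun setT Y' ->
  {ae P, forall t, Y t = Y' t} -> is_density P Y f -> is_density P Y' f.
Proof.
move=> mY mY' YY' [mf [f0 Yf]]; split => //; split => // A mA; rewrite -Yf//.
have mYA (W : T -> R) : measurable_fun setT W -> measurable (W @^-1` A).
  by move=> mW; rewrite -[X in measurable X]setTI; exact: mW.
have mYA1 := mYA Y mY; have mYA2 := mYA Y' mY'.
rewrite -[X in P X]setIT -[X in _ = P X]setIT -!integral_indic//.
apply: ae_eq_integral => //.
- by apply/measurable_EFinP; exact: measurable_indic.
- by apply/measurable_EFinP; exact: measurable_indic.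
- apply: filterS YY' => t YY' _; congr (_%:E); rewrite !indicE.
  congr (_%:R); congr nat_of_bool.
  by apply/idP/idP; rewrite !inE /preimage/= YY'.
Qed.

Lemma integral_EFin_lin_comb {d} {T : measurableType d} {R : realType}
    (P : probability T R) (I : Type) (r : seq I) (c : I -> R)
    (X : I -> T -> R) (m : R) :
  (forall i, P.-integrable setT (fun t => (X i t)%:E)) ->
  (forall i, \int[P]_t (X i t)%:E = m%:E)%E ->
  P.-integrable setT (fun t => (\sum_(i <- r) c i * X i t)%:E) /\
  (\int[P]_t (\sum_(i <- r) c i * X i t)%:E = ((\sum_(i <- r) c i) * m)%:E)%E.
Proof.
move=> iX EX; elim: r => [|i r [ir Er]].
  have -> : (fun t => (\sum_(i <- [::]) c i * X i t)%:E) = fun=> 0%:E.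
    by apply/funext => t; rewrite big_nil.
  rewrite big_nil mul0r integral_EFin_cst; split => //.
  exact: integrable_EFin_cst.
have -> : (fun t => (\sum_(j <- i :: r) c j * X j t)%:E) =
    fun t => (c i * X i t + \sum_(j <- r) c j * X j t)%:E.
  by apply/funext => t; rewrite big_cons.
have icX := integrable_EFinZ (c i) (X i) (iX i).
split; first exact: integrable_EFinD.
by rewrite integral_EFinD// integral_EFinZ// EX Er big_cons mulrDl EFinD.
Qed.

(** * Entropy of the gamma law and the strict comparison *)

Section gamma_entropy.
Context {d} {T : measurableType d} {R : realType}.
Variables (P : probability T R) (Z : T -> R) (a b k : R).
Hypotheses (a1 : 1 <= a) (b0 : 0 < b) (k0 : 0 <= k).
Hypotheses (mZ : measurable_fun setT Z) (Z0 : forall t, 0 < Z t).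
Hypothesis Zk : is_density P Z (fun x => k * gamma_kernel a b x).
Hypothesis iZ : P.-integrable setT (fun t => (Z t)%:E).
Local Notation mu := (@lebesgue_measure R).
Local Notation g := (fun x => k * gamma_kernel a b x).

Lemma gamma_const_gt0 : 0 < k.
Proof.
rewrite lt_neqAle k0 andbT; apply/eqP => k_0.
have := is_density_integral1 _ _ _ Zk.
rewrite integral0_eq; last by move=> x _; rewrite -k_0 mul0r.
by move=> /eqP; rewrite eqe eq_sym oner_eq0.
Qed.

(** Against the density, [Z^(- (a - 1))] cancels the power and leaves [k e^(- b x)], so it has a
    finite expectation. It dominates its own logarithm [- (a - 1) ln Z], while [(a - 1) Z] bounds
    [(a - 1) ln Z] from above. *)
Lemma gamma_ln_integrable : P.-integrable setT (fun t => ((a - 1) * ln (Z t))%:E).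
Proof.
have c0 : 0 <= a - 1 by rewrite subr_ge0.
have mpow : measurable_fun setT (fun t => (Z t) `^ (- (a - 1))).
  by apply: (measurableT_comp (measurable_powR _)).
have ipow : P.-integrable setT (fun t => ((Z t) `^ (- (a - 1)))%:E).
  apply/integrableP; split; first exact/measurable_EFinP.
  under eq_integral do rewrite /= ger0_norm ?powR_ge0//.
  rewrite (is_density_ge0_integral P Z _ mZ Zk (fun x => (x `^ (- (a - 1)))%:E)); last 2 first.
  - by apply/measurable_EFinP; exact: measurable_powR.
  - by move=> x; rewrite lee_fin powR_ge0.
  apply: (@le_lt_trans _ _ (\int[mu]_x (k / b * exponential_pdf b x)%:E)%E).
    apply: ge0_le_integral => //.
    - by move=> x _; rewrite -EFinM lee_fin !mulr_ge0 ?powR_ge0 ?gamma_kernel_ge0.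
    - apply/measurable_EFinP/measurable_funM; first exact: measurable_powR.
      by apply: measurable_funM => //; exact: measurable_gamma_kernel.
    - apply/measurable_EFinP/measurable_funM => //.
      exact: measurable_exponential_pdf.
    - move=> x _; rewrite -EFinM lee_fin /gamma_kernel; case: ifPn => x0; last first.
        by rewrite !mulr0 !mulr_ge0 ?invr_ge0 ?exponential_pdf_ge0 ?(ltW b0).
      rewrite exponential_pdfE ?(ltW x0)// (mulrA (k / b)) divfK ?gt_eqF// mulNr.
      rewrite mulrCA (mulrA (x `^ _)) -powRD; last by rewrite (gt_eqF x0) implybT.
      by rewrite addNr powRr0 mul1r.
  rewrite integral_EFinZ ?integral_exponential_pdf ?mule1 ?ltry//.
  exact: integrable_exponential_pdf.
have mln : measurable_fun setT (fun t => ((a - 1) * ln (Z t))%:E).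
  apply/measurable_EFinP/measurable_funM => //.
  exact: measurableT_comp.
apply: (le_integrable measurableT mln _ (integrable_EFinD _ _ ipow (integrable_EFinZ (a - 1) _ iZ))).
move=> t _ /=; rewrite lee_fin.
have p0 := powR_ge0 (Z t) (- (a - 1)).
have Zt0 := Z0 t.
have cZ0 : 0 <= (a - 1) * Z t by rewrite mulr_ge0// ltW.
rewrite [leRHS]ger0_norm ?addr_ge0// ler_norml; apply/andP; split.
  have : ln ((Z t) `^ (- (a - 1))) <= (Z t) `^ (- (a - 1)).
    by rewrite ltW// ln_sublinear// powR_gt0.
  by rewrite ln_powR; lra.
have : (a - 1) * ln (Z t) <= (a - 1) * Z t.
  by rewrite ler_wpM2l// ltW// ln_sublinear.
by lra.
Qed.

Let q z := - ln k - (a - 1) * ln z + b * z.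

Lemma ln_gamma_density x : 0 < x -> - ln (g x) = q x.
Proof.
move=> x0; have kp := gamma_const_gt0.
rewrite /gamma_kernel x0 !lnM ?posrE ?mulr_gt0 ?powR_gt0 ?expR_gt0//.
by rewrite ln_powR expRK /q; lra.
Qed.

Lemma measurable_neg_ln_density : measurable_fun setT q.
Proof.
apply: measurable_funD; last exact: measurable_funM.
by apply: measurable_funB => //; exact: measurable_funM.
Qed.

Lemma neg_ln_density_integral (W : T -> R) : P.-integrable setT (fun t => (W t)%:E) ->
  P.-integrable setT (fun t => ((a - 1) * ln (W t))%:E) ->
  P.-integrable setT (fun t => (q (W t))%:E) /\
  (\int[P]_t (q (W t))%:E = (- ln k)%:E - \int[P]_t ((a - 1) * ln (W t))%:E
     + b%:E * \int[P]_t (W t)%:E)%E.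
Proof.
move=> iW il.
have ic := integrable_EFin_cst P (- ln k).
have icl := integrable_EFinB _ _ ic il.
have ibW := integrable_EFinZ b _ iW.
split; first exact: (integrable_EFinD _ _ icl ibW).
rewrite (integral_EFinD _ _ icl ibW) (integral_EFinB _ _ ic il).
by rewrite integral_EFin_cst (integral_EFinZ _ _ iW).
Qed.

Lemma gamma_entropy : diff_entropy g = (\int[P]_t (q (Z t))%:E)%E.
Proof.
have [iq _] := neg_ln_density_integral Z iZ gamma_ln_integrable.
rewrite (is_density_integral P Z _ mZ Zk q measurable_neg_ln_density iq).
apply: eq_integral => x _; congr EFin.
have [x0|x0] := ltP 0 x; last first.
  by rewrite /gamma_kernel (ltNge 0 x) x0/= mulr0 mulr0 /xlnx eqxx oppr0.
have g0 : 0 < g x.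
  rewrite mulr_gt0 ?gamma_const_gt0// /gamma_kernel x0.
  by rewrite mulr_gt0 ?powR_gt0 ?expR_gt0.
by rewrite -ln_gamma_density// /xlnx gt_eqF// mulNr mulrC.
Qed.

(** The density is positive on []0, D]], an interval of positive length, so [Z] charges it. This is
    the source of strictness. *)
Lemma gamma_tail_lt1 (D : R) : 0 < D -> (P (Z @^-1` `]D, +oo[%classic) < 1)%E.
Proof.
move=> D0.
have mpre (A : set R) : measurable A -> measurable (Z @^-1` A).
  by move=> mA; rewrite -[X in measurable X]setTI; exact: mZ.
have PD : (P (Z @^-1` `]0%R, D]%classic) != 0)%E.
  have [mg [g0 Zg]] := Zk; rewrite Zg//; apply/eqP => I0.
  have mgE : measurable_fun `]0%R, D]%classic (EFin \o g).
    exact/measurable_funTS/measurable_EFinP.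
  have /(ae_eq_integral_abs mu (measurable_itv `]0%R, D]) mgE) :
      (\int[mu]_(x in `]0%R, D]) `|(EFin \o g) x| = 0)%E.
    by rewrite -[RHS]I0; apply: eq_integral => x _; rewrite /= ger0_norm.
  move=> [N [mN N0 DN]].
  have : (mu `]0%R, D]%classic <= mu N)%E.
    apply: le_measure; rewrite ?inE//; apply: subset_trans DN => x /= xD.
    apply/existsNP; exists xD => /= [[]]/eqP; apply/negP.
    move: xD; rewrite /= in_itv/= => /andP[x0 _].
    rewrite gt_eqF// mulr_gt0 ?gamma_const_gt0// /gamma_kernel x0.
    by rewrite mulr_gt0 ?powR_gt0 ?expR_gt0.
  rewrite [leRHS]N0 lebesgue_measure_itv/= lte_fin D0 oppr0 adde0 lee_fin.
  by rewrite leNgt D0.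
have := @measureU _ _ _ P _ _ (mpre `]0%R, D]%classic (measurable_itv _))
  (mpre `]D, +oo[%classic (measurable_itv _)).
have -> : Z @^-1` `]0%R, D]%classic `&` Z @^-1` `]D, +oo[%classic = set0.
  apply/seteqP; split => t //=; rewrite /preimage/= !in_itv/= andbT.
  by move=> [/andP[_ tD] Dt]; move: (le_lt_trans tD Dt); rewrite ltxx.
have -> : Z @^-1` `]0%R, D]%classic `|` Z @^-1` `]D, +oo[%classic = setT.
  apply/seteqP; split => t //= _; rewrite /preimage/= !in_itv/= andbT Z0/=.
  by have [h|h] := leP (Z t) D; [left|right].
move=> /(_ erefl) PU.
rewrite [ltRHS](_ : _ = (P (Z @^-1` `]0%R, D]%classic) +
  P (Z @^-1` `]D, +oo[%classic))%E); last by rewrite -(probability_setT P) -PU.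
rewrite -[ltLHS]add0e lteD2rE ?lt_neqAle; last by apply: fin_num_measure; exact: mpre.
by rewrite eq_sym PD measure_ge0.
Qed.

Lemma entropy_lt_gamma_entropy (Y : T -> R) (f : R -> R) (D : R) : 0 < D ->
  measurable_fun setT Y -> (forall t, 0 < Y t) -> is_density P Y f ->
  P.-integrable setT (fun t => (Y t)%:E) ->
  (\int[P]_t (Y t + D)%:E = \int[P]_t (Z t)%:E)%E ->
  (forall u : R, (0 <= u)%R -> \int[P]_t (expR (- (u * (Y t + D))))%:E <=
    \int[P]_t (expR (- (u * Z t)))%:E)%E ->
  (diff_entropy f < diff_entropy g)%E.
Proof.
move=> D0 mY Y0 Yf iY EYZ LYZ.
pose W t := Y t + D.
have mW : measurable_fun setT W by exact: measurable_funD.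
have W0 t : 0 < W t by rewrite addr_gt0.
have iW : P.-integrable setT (fun t => (W t)%:E).
  exact: (integrable_EFinD _ _ iY (integrable_EFin_cst P D)).
have c0 : 0 <= a - 1 by rewrite subr_ge0.
have ilW : P.-integrable setT (fun t => ((a - 1) * ln (W t))%:E).
  (* Since [W >= D], the logarithm lies between [ln D] and [W], so [W + |ln D|] dominates it. *)
  apply: integrable_EFinZ.
  have ibd := integrable_EFinD _ _ iW (integrable_EFin_cst P `|ln D|).
  apply: le_integrable ibd => //.
    by apply/measurable_EFinP; exact: measurableT_comp.
  move=> t _ /=; rewrite lee_fin [leRHS]ger0_norm; last first.
    by rewrite addr_ge0// ltW ?W0.
  have lnW : ln (W t) <= W t by rewrite ltW// ln_sublinear.
  have lnD : ln D <= ln (W t).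
    by rewrite ler_ln ?posrE// /W lerDr ltW.
  have := ler_norm (- ln D); rewrite normrN => nD.
  have := W0 t; have := normr_ge0 (ln D); rewrite ler_norml => *; apply/andP; split; lra.
have [iqW EqW] := neg_ln_density_integral W iW ilW.
have [iqZ EqZ] := neg_ln_density_integral Z iZ gamma_ln_integrable.
(* Equal means cancel the terms in [b]; the logarithms enter with the coefficient [- (a - 1) <= 0],
   which reverses their comparison. *)
have qWZ : (\int[P]_t (q (W t))%:E <= \int[P]_t (q (Z t))%:E)%E.
  rewrite EqW EqZ EYZ; apply: leeD2r; apply: leeB => //.
  exact: (ln_integral_ge P W Z (a - 1) c0 mW mZ W0 Z0 iZ ilW gamma_ln_integrable).
rewrite gamma_entropy.
have [mf [f0 Ef]] := Yf.
(* As [Y] is positive, [f] may be set to zero off the positive half-line; otherwise its values on a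
   null set there would spoil the pointwise Gibbs bound. *)
pose f1 x := if 0 < x then f x else 0.
have mf1 : measurable_fun setT f1.
  by apply: measurable_fun_ifT => //; exact: measurable_fun_ltr.
have Yf1 : is_density P Y f1.
  split => //; split; first by move=> x; rewrite /f1; case: ifP.
  move=> A mA.
  have -> : Y @^-1` A = Y @^-1` (A `&` `]0%R, +oo[%classic).
    apply/seteqP; split => t; rewrite /preimage/= in_itv/= andbT.
      by move=> At; split.
    by case.
  rewrite Ef; last exact: measurableI.
  rewrite integral_mkcondr; apply: eq_integral => x _.
  rewrite patchE /f1; case: ifPn; rewrite ?inE/= ?notin_setE/= in_itv/= andbT.
    by move=> ->.
  by move=> /negP/negPf ->.
rewrite (is_density_entropy_unique P Y f f1 Yf Yf1).
have [_ [f10 _]] := Yf1.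
(* The shifted reference density, cut to the half-line where [Y] lives; its mass is that of [Z]
   beyond [D]. *)
pose g1 x := if 0 < x then g (x + D) else 0.
have mgk : measurable_fun setT g by case: Zk.
have mg1 : measurable_fun setT g1.
  apply: measurable_fun_ifT => //; first exact: measurable_fun_ltr.
  by apply: (measurableT_comp mgk); exact: measurable_funD.
have gpos x : 0 < x -> 0 < g x.
  move=> x0; rewrite mulr_gt0 ?gamma_const_gt0// /gamma_kernel x0.
  by rewrite mulr_gt0 ?powR_gt0 ?expR_gt0.
have g10 x : 0 <= g1 x.
  by rewrite /g1; case: ifPn => // x0; rewrite ltW// gpos// addr_gt0.
have Eg1 : (\int[mu]_x (g1 x)%:E = P (Z @^-1` `]D, +oo[%classic))%E.
  have [_ [gk0 ->//]] := Zk.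
  rewrite [RHS]integral_mkcond.
  pose h y : \bar R := if D < y then (g y)%:E else 0%E.
  have mh : measurable_fun setT h.
    apply: measurable_fun_ifT => //; first exact: measurable_fun_ltr.
    exact/measurable_EFinP.
  have h0 y : (0 <= h y)%E by rewrite /h; case: ifP => // _; rewrite lee_fin.
  transitivity (\int[mu]_x h (1 * x + D)%R)%E.
    apply: eq_integral => x _; rewrite /h /g1 mul1r ltrDr.
    by case: ifP.
  rewrite (ge0_integral_affine 1 D h ltr01 mh h0) invr1 mul1e.
  apply: eq_integral => x _; rewrite patchE /h.
  case: ifPn => [Dx|Dx]; first by rewrite mem_set//= in_itv/= Dx.
  by rewrite memNset//= in_itv/= (negPf Dx).
have mqD : measurable_fun setT (fun x : R => q (x + D)).
  by apply: (measurableT_comp measurable_neg_ln_density); exact: measurable_funD.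
have iqf : mu.-integrable setT (fun x => (q (x + D) * f1 x)%:E).
  exact: (is_density_integrableM P Y f1 mY Yf1 (fun x : R => q (x + D)) mqD iqW).
have Eqf : (\int[P]_t (q (W t))%:E = \int[mu]_x (q (x + D) * f1 x)%:E)%E.
  exact: (is_density_integral P Y f1 mY Yf1 (fun x : R => q (x + D)) mqD iqW).
have PDlt := gamma_tail_lt1 D D0.
have ig1 : mu.-integrable setT (fun x => (g1 x)%:E).
  apply/integrableP; split; first exact/measurable_EFinP.
  under eq_integral do rewrite /= ger0_norm ?g10//.
  by rewrite Eg1 (lt_trans PDlt)// ltry.
have if1 := is_density_integrable P Y f1 Yf1.
have iqg := integrable_EFinD _ _ iqf ig1.
apply: (@le_lt_trans _ _ (\int[mu]_x (q (x + D) * f1 x + g1 x - f1 x)%:E)%E).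
  apply: le_integral_integrable.
  - by apply: measurableT_comp => //; apply: measurableT_comp => //; exact: measurable_xlnx.
  - exact: (integrable_EFinB _ _ iqg if1).
  - move=> x; have [x0|x0] := ltP 0 x; last first.
      by rewrite /f1 /g1 (ltNge 0 x) x0/= /xlnx eqxx oppr0 mulr0 !addr0.
    have xD : 0 < x + D by rewrite addr_gt0.
    have := gibbs_pointwise (f1 x) (g (x + D)) (f10 x) (gpos _ xD).
    have -> : g1 x = g (x + D) by rewrite /g1 x0.
    by rewrite (ln_gamma_density _ xD) (mulrC (q _)).
rewrite (integral_EFinB _ _ iqg if1) (integral_EFinD _ _ iqf ig1) -Eqf Eg1.
rewrite (is_density_integral1 P Y f1 Yf1).
have qWfin := integrable_fin_num measurableT iqW.
(* What remains is [P(Z > D) < 1]; subtracting the finite expectation of [q (W t)] is legitimate by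
   [qWfin]. *)
apply: lt_le_trans qWZ.
rewrite lteBlDr// lteD2lE//.
Qed.

End gamma_entropy.

(** * Weighted sums of gamma variables *)

(** With [b = sqrt n], the positive sum of the squares [(c i - 1 / b)^2] expands to [2 - 2 s / b],
    where [s] is the sum of the [c i]. *)
Lemma sum_le_sqrt {R : realType} (n : nat) (c : 'I_n -> R) : (0 < n)%N ->
  \sum_(i < n) c i ^+ 2 = 1 -> (exists i, c i != (Num.sqrt n%:R)^-1) ->
  \sum_(i < n) c i < Num.sqrt n%:R.
Proof.
move=> n0 c21 [j cj]; set b := Num.sqrt n%:R.
have b0 : 0 < b by rewrite sqrtr_gt0 ltr0n.
have bn : n%:R = b * b by rewrite -expr2 sqr_sqrtr.
have : 0 < \sum_(i < n) (c i - b^-1) ^+ 2.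
  rewrite (bigD1 j)//= ltr_pwDl ?sumr_ge0// => [|i _]; last exact: sqr_ge0.
  by rewrite exprn_even_gt0// subr_eq0.
under eq_bigr do rewrite sqrrB.
rewrite big_split/= sumrB c21 sumrMnl -mulr_suml sumr_const card_ord.
have -> : b^-1 ^+ 2 *+ n = 1.
  by rewrite -[LHS]mulr_natr bn; field; rewrite gt_eqF.
rewrite -mulr_natr => h.
have : (\sum_(i < n) c i) / b < 1 by lra.
by rewrite ltr_pdivrMr// mul1r.
Qed.

Section positive_case.
Context {d0} {T : measurableType d0} {R : realType}.
Variables (P : probability T R) (alpha : R) (n : nat) (X : 'I_n -> T -> R)
  (d : 'I_n -> R).
Hypotheses (alpha0 : 0 < alpha) (mX : forall i, measurable_fun setT (X i))
  (indX : mutually_independent P X)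
  (Xalpha : forall i, is_density P (X i) (gamma_pdf alpha))
  (n_alpha : 1 <= n%:R * alpha) (d_ge0 : forall i, 0 <= d i)
  (d21 : \sum_(i < n) d i ^+ 2 = 1).
Hypothesis X0 : forall i t, 0 < X i t.
Let b := Num.sqrt (n%:R : R).
Let Y t := \sum_(i < n) d i * X i t.
Let Z t := b^-1 * \sum_(i < n) X i t.

Let n0 : (0 < n)%N.
Proof. by rewrite lt0n; apply: contraTneq n_alpha => ->; rewrite mul0r -ltNge ltr01. Qed.

Let b0 : 0 < b. Proof. by rewrite sqrtr_gt0 ltr0n. Qed.

Lemma exists_pos_weight : exists i, 0 < d i.
Proof.
apply/existsP; apply: contraT => /existsPn d0'.
suff : \sum_(i < n) d i ^+ 2 = 0 by rewrite d21 => /eqP; rewrite oner_eq0.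
apply: big1 => i _.
suff -> : d i = 0 by rewrite expr0n.
by apply/eqP; rewrite eq_le d_ge0 andbT leNgt d0'.
Qed.

Lemma entropy_lt_of_unequal (f g : R -> R) : (exists i, d i != b^-1) ->
  is_density P Y f -> is_density P Z g ->
  (diff_entropy f < diff_entropy g)%E.
Proof.
move=> dne Yf Zg.
have sb := sum_le_sqrt n d n0 d21 dne.
have [k k0 Zk] := is_density_gamma_equal_sum P n X alpha b mX indX Xalpha n0 b0.
rewrite (is_density_entropy_unique P Z _ _ Zg Zk).
pose i0 := Ordinal n0.
have iX i := gamma_integrable P (X i) alpha (mX i) (X0 i) (Xalpha i).
(* Expressing the mean through the common density makes it the same number [m] for all [i]. *)
have EXg i : (\int[P]_t (X i t)%:E = \int[lebesgue_measure]_x (x * gamma_pdf alpha x)%:E)%E.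
  exact: (is_density_integral P (X i) _ (mX i) (Xalpha i) (fun x : R => x) _ (iX i)).
pose m := fine (\int[lebesgue_measure]_x (x * gamma_pdf alpha x)%:E)%E.
have EX i : (\int[P]_t (X i t)%:E = m%:E)%E.
  by rewrite /m -(EXg i) fineK//; exact: integrable_fin_num (iX i).
have am : alpha <= m.
  exact: (gamma_mean_ge P (X i0) alpha alpha0 (mX i0) (X0 i0) (Xalpha i0) m (EX i0)).
have m0 : 0 < m by exact: lt_le_trans am.
have ZE t : Z t = \sum_(i < n) b^-1 * X i t by rewrite /Z mulr_sumr.
have mY : measurable_fun setT Y.
  by apply: measurable_sum => i; exact: measurable_funM.
have mZ : measurable_fun setT Z.
  by apply: measurable_funM => //; exact: measurable_sum.
have Y0 t : 0 < Y t.
  have [i di] := exists_pos_weight.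
  rewrite /Y (bigD1 i)//= ltr_pwDl ?mulr_gt0// sumr_ge0// => j _.
  by rewrite mulr_ge0// ltW.
have Z0 t : 0 < Z t.
  rewrite mulr_gt0 ?invr_gt0// (bigD1 i0)//= ltr_pwDl// sumr_ge0// => j _.
  exact: ltW.
have [iY EY] := integral_EFin_lin_comb P _ (index_enum 'I_n) d X m iX EX.
have [iZ EZ] := integral_EFin_lin_comb P _ (index_enum 'I_n) (fun=> b^-1) X m iX EX.
have iZ' : P.-integrable setT (fun t => (Z t)%:E).
  by rewrite (_ : (fun t => _) = (fun t => (\sum_(i < n) b^-1 * X i t)%:E))//;
    apply/funext => t; rewrite ZE.
pose D := m * (b - \sum_(i < n) d i).
have D0 : 0 < D by rewrite mulr_gt0// subr_gt0.
apply: (@entropy_lt_gamma_entropy _ _ _ P Z (n%:R * alpha) b k n_alpha b0 k0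
  mZ Z0 Zk iZ' Y f D D0 mY Y0 Yf iY).
(* By the choice of [D] both means equal [m b], as [n / b = b]. *)
- rewrite (integral_EFinD _ (fun=> D) iY (integrable_EFin_cst P D)).
  rewrite integral_EFin_cst [X in (X + _)%E]EY.
  rewrite (_ : (\int[P]_t (Z t)%:E)%E = (\int[P]_t (\sum_(i < n) b^-1 * X i t)%:E)%E).
    rewrite [RHS]EZ -EFinD; congr EFin; rewrite sumr_const card_ord -[_ *+ n]mulr_natr.
    have -> : n%:R = b * b by rewrite -expr2 sqr_sqrtr.
    by rewrite /D mulKf ?gt_eqF//; ring.
  by apply: eq_integral => t _; rewrite ZE.
- move=> u u0.
  have -> : (\int[P]_t (expR (- (u * Z t)))%:E =
      (\prod_(i < n) (1 + u * b^-1) `^ (- alpha))%:E)%E.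
    rewrite -(partial_sum_laplace P n X (fun=> b^-1) alpha u mX indX Xalpha u0);
      last by move=> _; rewrite invr_ge0 ltW.
    by apply: eq_integral => t _; rewrite ZE.
  have -> : (\int[P]_t (expR (- (u * (Y t + D))))%:E =
      (expR (- (u * D)) * \prod_(i < n) (1 + u * d i) `^ (- alpha))%:E)%E.
    rewrite EFinM -(partial_sum_laplace P n X d alpha u mX indX Xalpha u0 d_ge0).
    rewrite -ge0_integralZl//; last first.
      apply/measurable_EFinP; do 2! apply: measurableT_comp => //.
      exact: measurable_funM.
    apply: eq_integral => t _; rewrite -EFinM -expRD; congr (expR _)%:E.
    by rewrite /Y; ring.
  rewrite lee_fin; apply: laplace_product_le => //.
  exact: ltW.
Qed.

Lemma theorem1_positive :
  (exists f, is_density P Y f) /\ (exists g, is_density P Z g) /\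
  forall f g, is_density P Y f -> is_density P Z g ->
    (diff_entropy f <= diff_entropy g)%E /\
    (diff_entropy f = diff_entropy g <-> forall i, d i = b^-1).
Proof.
split.
  exact: (exists_density_partial_sum P n X d _ mX indX Xalpha d_ge0 exists_pos_weight).
split.
  have [k k0 Zk] := is_density_gamma_equal_sum P n X alpha b mX indX Xalpha n0 b0.
  by eexists; exact: Zk.
move=> f g Yf Zg.
(* Equal weights make [Y] and [Z] the same function; any other weights give a strict inequality,
   which settles both directions of the equality case. *)
have [/forallP dE|/forallPn dne] := boolP [forall i, d i == b^-1].
  have dbE i : d i = b^-1 by exact/eqP.
  have YZ : Y = Z.
    apply/funext => t; rewrite /Y /Z mulr_sumr.
    by apply: eq_bigr => i _; rewrite dbE.
  rewrite YZ in Yf.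
  by rewrite (is_density_entropy_unique P Z _ _ Yf Zg).
have lt_fg := entropy_lt_of_unequal f g dne Yf Zg.
split; first exact: ltW.
split=> [fg|dE]; first by rewrite fg ltxx in lt_fg.
by have [i] := dne; rewrite dE eqxx.
Qed.

End positive_case.

Theorem theorem1 (R : realType) (d0 : measure_display) (T : measurableType d0)
    (P : probability T R) (alpha : R) (n : nat) (X : 'I_n -> T -> R)
    (d : 'I_n -> R) :
  0 < alpha ->
  (forall i, measurable_fun setT (X i)) ->
  mutually_independent P X ->
  (forall i, is_density P (X i) (gamma_pdf alpha)) ->
  1 <= n%:R * alpha ->
  (forall i, 0 <= d i) ->
  \sum_(i < n) d i ^+ 2 = 1 ->
  let Y := fun t => \sum_(i < n) d i * X i t in
  let Z := fun t => (Num.sqrt n%:R)^-1 * \sum_(i < n) X i t in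
  (exists f, is_density P Y f) /\ (exists g, is_density P Z g) /\
  forall f g, is_density P Y f -> is_density P Z g ->
    (diff_entropy f <= diff_entropy g)%E /\
    (diff_entropy f = diff_entropy g <-> forall i, d i = (Num.sqrt n%:R)^-1).
Proof.
move=> alpha0 mX indX Xalpha n_alpha d_ge0 d21 Y Z.
(* The X i are only almost surely positive; replace them by positive versions. *)
pose phi (x : R) : R := if 0 < x then x else 1.
have mphi : measurable_fun setT phi.
  by apply: measurable_fun_ifT => //; exact: measurable_fun_ltr.
have mphiA (A : set R) : measurable A -> measurable (phi @^-1` A).
  by move=> mA; rewrite -[S in measurable S]setTI; exact: mphi.
pose X' i t := phi (X i t).
have mX' i : measurable_fun setT (X' i) by exact: measurableT_comp.
have X'0 i t : 0 < X' i t by rewrite /X' /phi; case: ifP.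
have indX' : mutually_independent P X'.
  by move=> B mB; apply: (indX (fun i => phi @^-1` B i)) => i; exact: mphiA.
have X'alpha i : is_density P (X' i) (gamma_pdf alpha).
  have [mg [g0 Xg]] := Xalpha i; split => //; split => // A mA.
  rewrite (_ : X' i @^-1` A = X i @^-1` (phi @^-1` A))// Xg; last exact: mphiA.
  rewrite integral_mkcond [RHS]integral_mkcond; apply: eq_integral => x _.
  (* [phi] is the identity for [x > 0], and elsewhere the density vanishes. *)
  rewrite !patchE /gamma_pdf; have [x0|x0] := ltP 0 x.
    congr (if _ then _ else _); apply/idP/idP; rewrite !inE /preimage/= /phi x0//.
  by rewrite !if_same.
(* For one [i] the exceptional set is [X i <= 0], null because the density vanishes there; finitely
   many indices are then combined. *)
have XX' : {ae P, forall t, forall i, X i t = X' i t}.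
  apply: filter_forall => i.
  exists (X i @^-1` `]-oo, 0%R]%classic); split.
  - by rewrite -[S in measurable S]setTI; exact: mX.
  - have [_ [_ ->//]] := Xalpha i.
    apply: integral0_eq => x /=; rewrite in_itv/= => x0.
    by rewrite /gamma_pdf ltNge x0.
  - move=> t /=; rewrite /X' /phi in_itv/=; by case: ltP.
pose Y' t := \sum_(i < n) d i * X' i t.
pose Z' t := (Num.sqrt n%:R)^-1 * \sum_(i < n) X' i t.
have mlin (V : 'I_n -> T -> R) : (forall i, measurable_fun setT (V i)) ->
    measurable_fun setT (fun t => \sum_(i < n) d i * V i t).
  by move=> mV; apply: measurable_sum => i; exact: measurable_funM.
have mavg (V : 'I_n -> T -> R) : (forall i, measurable_fun setT (V i)) ->
    measurable_fun setT (fun t => (Num.sqrt n%:R)^-1 * \sum_(i < n) V i t).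
  by move=> mV; apply: measurable_funM => //; exact: measurable_sum.
have YY' : {ae P, forall t, Y t = Y' t}.
  by apply: filterS XX' => t XX't; apply: eq_bigr => i _; rewrite XX't.
have ZZ' : {ae P, forall t, Z t = Z' t}.
  apply: filterS XX' => t XX't; rewrite /Z /Z'; congr (_ * _).
  by apply: eq_bigr => i _; rewrite XX't.
have sym (V W : T -> R) : {ae P, forall t, V t = W t} -> {ae P, forall t, W t = V t}.
  by apply: filterS => t ->.
have [[f0 Yf0] [[g0 Zg0] main]] :=
  theorem1_positive P alpha n X' d alpha0 mX' indX' X'alpha n_alpha d_ge0 d21 X'0.
split.
  exists f0; apply: (is_density_ae P Y' Y) Yf0; [exact: mlin|exact: mlin|exact: sym].
split.
  exists g0; apply: (is_density_ae P Z' Z) Zg0; [exact: mavg|exact: mavg|exact: sym].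
move=> f g Yf Zg; apply: main.
- by apply: (is_density_ae P Y Y') Yf => //; exact: mlin.
- by apply: (is_density_ae P Z Z') Zg => //; exact: mavg.
Qed.
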